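(* Let $G$ be a countable discrete amenable group, let $\pi:\mathbf{X}\to\mathbf{Y}$ be an extension of measure-preserving $G$-systems with $\mathbf{X}$ ergodic, and let $(F_n)$ be any F\o lner sequence for $G$. For $t>0$ let $U_t(n)=\exp(t\cdot n)$. Then for every partition $P$ of $X$ and every $t>0$, $$h_{\mathrm{slow}}^{U_t,(F_n)}(\mathbf{X},P\,|\,\pi)=\begin{cases}\infty & \text{if } t<h_{\mathrm{KS}}(\mathbf{X},P\,|\,\pi),\\ 0 & \text{if } t>h_{\mathrm{KS}}(\mathbf{X},P\,|\,\pi).\end{cases}$$ Equivalently, for every partition $P$ of $X$, $$\sup_{\epsilon>0}\ \limsup_{n\to\infty}\ \frac{\log\operatorname{cov}(\mu,P,F_n,\epsilon\,|\,\pi)}{|F_n|}\ =\ h_{\mathrm{KS}}(\mathbf{X},P\,|\,\pi).$$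
   Context: A (left) F\o lner sequence for $G$ is a sequence of finite nonempty sets $F_n\subseteq G$ with $|gF_n\cap F_n|/|F_n|\to 1$ for each $g\in G$. A system $\mathbf{X}=(X,\mathcal{B}_X,\mu,T)$ is a measure-preserving action $T=(T^g)_{g\in G}$ (with $T^{gh}=T^gT^h$) on a standard probability space. A factor map (equivalently, an extension) $\pi:\mathbf{X}\to\mathbf{Y}=(Y,\mathcal{B}_Y,\nu,S)$ is a measurable map with $\pi_*\mu=\nu$ and $\pi T^g=S^g\pi$ a.e.; $\mu=\int\mu_y\,d\nu(y)$ denotes the disintegration of $\mu$ over $\pi$. All partitions are finite and measurable. For $P=\{P_0,\dots,P_{r-1}\}$, $P(x)$ is the index $i$ with $x\in P_i$. For finite $F\subseteq G$, $P^F=\bigvee_{f\in F}T^{f^{-1}}P$ and $d_{P,F}(x,x')=\frac1{|F|}\sum_{f\in F}1_{P(T^fx)\ne P(T^fx')}$; $\operatorname{diam}_{P,F}$ is the diameter with respect to this pseudo-metric. For a probability measure $\lambda$ on $X$ and $\epsilon>0$, $\operatorname{cov}(\lambda,P,F,\epsilon)$ is the smallest $M$ such that there exist $E_1,\dots,E_M\subseteq X$ with $\operatorname{diam}_{P,F}(E_i)\le\epsilon$ for all $i$ and $\lambda(\bigcup E_i)\ge1-\epsilon$. The relative covering number is $$\operatorname{cov}(\mu,P,F,\epsilon\,|\,\pi)=\inf_{S'\subseteq Y:\ \nu(S')\ge1-\epsilon}\ \sup_{y\in S'}\operatorname{cov}(\mu_y,P,F,\epsilon).$$ For an increasing function $U:\mathbb{N}\to(0,\infty)$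 with $U(n)\to\infty$ (a rate function), $$h_{\mathrm{slow}}^{U,(F_n)}(\mathbf{X},P\,|\,\pi)=\sup_{\epsilon>0}\limsup_{n\to\infty}\frac{\operatorname{cov}(\mu,P,F_n,\epsilon\,|\,\pi)}{U(|F_n|)}\in[0,\infty].$$ $h_{\mathrm{KS}}(\mathbf{X},P\,|\,\pi)$ is the classical relative Kolmogorov--Sinai entropy rate, $\lim_{n\to\infty}\frac1{|F_n|}H_\mu(P^{F_n}\,|\,\pi^{-1}\mathcal{B}_Y)$, where $H_\mu(\cdot|\cdot)$ is conditional Shannon entropy with natural logarithm (the limit exists and does not depend on the F\o lner sequence).
   Formalization: The group G is assumed infinite: for finite G a Følner sequence is eventually constantly G, so the slow entropy for U_t is finite and positive for every t and the claimed value 0 for t above the entropy fails. *)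

(* Defs.v *)
From HB Require Import structures.
From mathcomp Require Import all_boot all_order all_algebra.
From mathcomp Require Import finmap.
From mathcomp Require Import all_classical all_reals all_analysis.

Set Implicit Arguments.
Unset Strict Implicit.
Unset Printing Implicit Defensive.

Import Order.TTheory GRing.Theory Num.Theory.
Import numFieldNormedType.Exports.

Local Open Scope classical_set_scope.
Local Open Scope ring_scope.

Section Groups.
Context (R : realType) (G : groupType).

Definition folner (F : nat -> {fset G}) : Prop :=
  (forall n, F n != fset0) /\
  (forall g : G,
     (#|` [fset (g * x)%g | x in F n] `&` F n|%fset%:R / #|` F n|%:R : R)
       @[n --> \oo] --> (1 : R)).

(* For countable discrete groups amenability is the existence of a Folner
   sequence *)
Definition amenable : Prop := exists F : nat -> {fset G}, folner F.

End Groups.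
Arguments folner R {G} F.
Arguments amenable R G : clear implicits.

(* The sigma-algebra of T is, up to a bijection, the Borel sigma-algebra of a
   Polish space *)
Definition standard_borel (R : realType) (d : measure_display)
    (T : measurableType d) : Prop :=
  exists (P : completePseudoMetricType R) (f : T -> P),
    [/\ hausdorff_space P, @second_countable P, bijective f &
        forall A : set T, measurable A <-> <<s [set U : set P | open U] >> (f @` A)].
Arguments standard_borel R {d} T.

Section Systems.
Context (R : realType) (G : groupType).

Definition mp_system (d : measure_display) (X : measurableType d)
    (mu : probability X R) (T : G -> X -> X) : Prop :=
  [/\ standard_borel R X,
      forall g, measurable_fun [set: X] (T g),
      forall g A, measurable A -> mu (T g @^-1` A) = mu A,
      forall x, T 1%g x = x &
      forall g h x, T (g * h)%g x = T g (T h x)].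

Definition ergodic (d : measure_display) (X : measurableType d)
    (mu : probability X R) (T : G -> X -> X) : Prop :=
  forall A : set X, measurable A -> (forall g, T g @^-1` A = A) ->
    mu A = 0%E \/ mu A = 1%E.

Definition factor_map (dX dY : measure_display)
    (X : measurableType dX) (Y : measurableType dY)
    (mu : probability X R) (T : G -> X -> X)
    (nu : probability Y R) (S : G -> Y -> Y) (pi : X -> Y) : Prop :=
  [/\ measurable_fun [set: X] pi,
      forall B, measurable B -> mu (pi @^-1` B) = nu B &
      forall g, \forall x \ae mu, pi (T g x) = S g (pi x)].

Definition disintegration (dX dY : measure_display)
    (X : measurableType dX) (Y : measurableType dY)
    (mu : probability X R) (nu : probability Y R) (pi : X -> Y)
    (muy : R.-pker Y ~> X) : Prop :=
  (forall A, measurable A -> mu A = \int[nu]_y muy y A)%E /\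
  \forall y \ae nu, muy y (pi @^-1` [set y]) = 1%E.

End Systems.

(* A finite partition {P_0, ..., P_(r-1)} is encoded by its index function
   x |-> P(x); its cells are the sets P @^-1` [set i]. *)
Definition measurable_partition (d : measure_display) (X : measurableType d)
    (I : finType) (P : X -> I) : Prop :=
  forall i, measurable (P @^-1` [set i]).

Section Covering.
Context (R : realType) (G : groupType) (dX : measure_display)
  (X : measurableType dX) (T : G -> X -> X) (I : finType) (P : X -> I).

(* The join of the partitions T^(f^-1) P for f in F: the index of the cell of x
   is the word f |-> P(T^f x). *)
Definition join_partition (F : {fset G}) (x : X) : {ffun F -> I} :=
  [ffun f => P (T (val f) x)].

Definition hamming (F : {fset G}) (x x' : X) : R :=
  (\sum_(f <- F) (P (T f x) != P (T f x'))%:R) / #|` F|%:R.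

Definition hamming_diam (F : {fset G}) (E : set X) : R :=
  sup [set hamming F x x' | x in E & x' in E].

Definition cov (la : {measure set X -> \bar R}) (F : {fset G}) (eps : R) :
    \bar R :=
  ereal_inf [set z | exists (M : nat) (E : 'I_M -> set X),
    [/\ forall i, measurable (E i),
        forall i, hamming_diam F (E i) <= eps,
        ((1 - eps)%:E <= la (\bigcup_i E i))%E &
        z = M%:R%:E]].

Context (dY : measure_display) (Y : measurableType dY) (nu : probability Y R)
  (muy : R.-pker Y ~> X).

(* For eps >= 1 the set S' may be empty, and then the supremum is -oo.  This is
   immaterial below, as rel_cov is nonincreasing in eps and only its suprema
   over all eps > 0 are used. *)
Definition rel_cov (F : {fset G}) (eps : R) : \bar R :=
  ereal_inf [set z | exists S' : set Y,
    [/\ measurable S', ((1 - eps)%:E <= nu S')%E &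
        z = ereal_sup [set cov (muy y) F eps | y in S']]].

Definition slow_entropy (U : nat -> R) (F : nat -> {fset G}) : \bar R :=
  ereal_sup [set limn_esup (fun n =>
      rel_cov (F n) eps * ((U #|` F n|)^-1)%:E)%E | eps in [set e | 0 < e]].

Definition log_cov_rate (F : nat -> {fset G}) : \bar R :=
  ereal_sup [set limn_esup (fun n =>
      lne (rel_cov (F n) eps) * (#|` F n|%:R^-1)%:E)%E
    | eps in [set e | 0 < e]].

Definition shannon_entropy (la : {measure set X -> \bar R}) (J : finType)
    (Q : X -> J) : R :=
  - \sum_(j : J) fine (la (Q @^-1` [set j])) * ln (fine (la (Q @^-1` [set j]))).

(* H_mu(Q | pi^-1 B_Y): the conditional measures of mu given pi^-1 B_Y are the
   fibre measures muy. *)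
Definition cond_entropy (J : finType) (Q : X -> J) : \bar R :=
  (\int[nu]_y (shannon_entropy (muy y) Q)%:E)%E.

(* The common limit along all Folner sequences *)
Definition ks_entropy : \bar R :=
  xget 0%E [set h : \bar R | forall F : nat -> {fset G}, folner R F ->
    ((#|` F n|%:R^-1)%:E * cond_entropy (join_partition (F n)))%E
      @[n --> \oo] --> h].

End Covering.

Definition exp_rate (R : realType) (t : R) (n : nat) : R := expR (t * n%:R).

(* Main.v *)
Require Import Defs.
From HB Require Import structures.
From mathcomp Require Import all_boot all_order all_algebra.
From mathcomp Require Import finmap.
From mathcomp Require Import all_classical all_reals all_analysis.
From mathcomp Require Import measurable_realfun ring lra.
Import Order.TTheory GRing.Theory Num.Theory.
Import numFieldNormedType.Exports.
Local Open Scope classical_set_scope.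
Local Open Scope ring_scope.

(** Write H(F) for the mean fibre entropy of the join of the translates of P
    over a finite set F of group elements, and let h be the infimum of
    H(K) / |K| over all nonempty finite K.  Both halves of the theorem compare
    covering numbers with h, and h turns out to be the relative entropy.

    Upper bound.  For finite K and F, the translates K g with g in K^-1 F cover
    every point of F exactly |K| times.  The generalized Hoelder inequality,
    applied one coordinate at a time, gives the multiplicative form of
    Shearer's inequality: if Q_g is the marginal on the window F :&: K g of a
    probability measure on words over F, then the product of the
    Q_g ^ (1 / |K|) is a subprobability on words (multiplicative_shearer).
    Hence - 1 / |K| times the sum of the ln Q_g is a code length satisfying
    Kraft's inequality (kraft).  At a point x of the fibre over y, the
    equivariance of the fibre measures bounds this code length by 1 / |K| times
    the sum over g in K^-1 F of phi (T^g x), where phi is the information of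
    the partition P^K given the fibre (ae_code_length_le).  Two things follow.
    - Gibbs' inequality turns this into
      H(F) <= |K^-1 F| / |K| * mean phi, and the mean of phi is about H(K).
      When F runs through a Folner sequence, |K^-1 F| / |F| tends to 1, so
      H(F) / |F| tends to h along every Folner sequence (cvg_entropy_rate)
      and h is the relative entropy rate (ks_entropyE).
    - Ergodicity enters through the mean ergodic theorem (mean_ergodic): for K
      with H(K) / |K| close to h, outside a set of small measure the code
      length of x is at most |F| (h + e).  By Kraft's inequality the words with
      such a code length number at most exp (|F| (h + e)), and their cells have
      Hamming diameter 0 (rel_cov_le, rel_cov_upper).
    To keep phi bounded and all logarithms finite, every fibre measure is mixed
    with a small multiple eta of the uniform measure on words.

    Lower bound.  If M sets of Hamming diameter at most eps cover all but eps
    of a fibre, then describing a word by the number of the covering set,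
    followed by the few places where it differs from a centre of that set,
    bounds the fibre entropy by ln M plus a small multiple of |F|
    (entropy_le_covering).  Since |F| h <= H(F) for every F, the covering
    numbers are at least exp (|F| (h - e)), up to a factor 4 (rel_cov_ge,
    rel_cov_lower).

    The mean ergodic theorem is proved by von Neumann's argument in its
    midpoint form: among averages of translates of a centred bounded function,
    a sequence that nearly minimizes the L2 norm converges almost everywhere
    to an invariant function, which is constant by ergodicity and 0 because its
    integral is 0 (translate_mean_small). *)

Set Implicit Arguments.
Unset Strict Implicit.
Unset Printing Implicit Defensive.

(** * Products of marginals over a uniform cover *)

Section GeometricMeans.
Context (R : realType).

(** The inequality of arithmetic and geometric means, with the geometric mean
    written as the exponential of a mean of logarithms. *)
Lemma expR_mean_ln_le_mean (J : finType) (D : {set J}) (b : J -> R) :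
  (0 < #|D|)%N -> (forall j, 0 < b j) ->
  expR (#|D|%:R^-1 * \sum_(j in D) ln (b j)) <= #|D|%:R^-1 * \sum_(j in D) b j.
Proof.
move=> D0 b0; set k : R := #|D|%:R; set m := _ * \sum_(j in D) b j.
have k0 : 0 < k by rewrite ltr0n.
have m0 : 0 < m.
  rewrite mulr_gt0 ?invr_gt0//; move/card_gt0P : D0 => [j jD].
  rewrite (bigD1 j)//= ltr_pwDl//.
  by apply: sumr_ge0 => i _; exact: ltW.
rewrite -[leRHS](@lnK R) ?posrE// ler_expR ler_pdivrMl//.
(* tangent line of the logarithm at the arithmetic mean *)
have tangent j : ln (b j) <= ln m + (b j / m - 1).
  rewrite -[X in ln X](@divfK _ m) ?gt_eqF// lnM ?posrE ?divr_gt0//.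
  rewrite addrC lerD2l -{1}[b j / m](subrKC 1) le_ln1Dx//.
  by rewrite ltrBrDl subrr divr_gt0.
apply: (le_trans (ler_sum _ (fun j _ => tangent j))).
rewrite big_split/= sumr_const sumrB sumr_const -mulr_suml -mulr_natl.
have -> : \sum_(j in D) b j = k * m by rewrite /m mulVKf ?gt_eqF.
by rewrite mulfK ?gt_eqF// subrr addr0.
Qed.

(** The Hoelder inequality for #|D| functions with all exponents #|D|: after
    dividing each function by its sum, it is the inequality of arithmetic and
    geometric means at every point, summed over all points. *)
Lemma sum_expR_mean_ln (I J : finType) (D : {set J}) (a : J -> I -> R) :
  (0 < #|D|)%N -> (forall j i, 0 < a j i) -> (0 < #|I|)%N ->
  \sum_i expR (#|D|%:R^-1 * \sum_(j in D) ln (a j i)) <=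
  expR (#|D|%:R^-1 * \sum_(j in D) ln (\sum_i a j i)).
Proof.
move=> D0 a0 /card_gt0P[i0 _]; set k : R := #|D|%:R.
have k0 : 0 < k by rewrite ltr0n.
pose s j := \sum_i a j i.
have s0 j : 0 < s j.
  rewrite /s (bigD1 i0)//= ltr_pwDl//.
  by apply: sumr_ge0 => i _; exact: ltW.
have scaled i : expR (k^-1 * \sum_(j in D) ln (a j i)) <=
    expR (k^-1 * \sum_(j in D) ln (s j)) * (k^-1 * \sum_(j in D) (a j i / s j)).
  apply: le_trans; last first.
    apply: ler_wpM2l; first exact: expR_ge0.
    by apply: expR_mean_ln_le_mean => // j; rewrite divr_gt0.
  rewrite -expRD -mulrDr -big_split/= le_eqVlt; apply/orP; left; apply/eqP.
  congr (expR (_ * _)); apply: eq_bigr => j _.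
  by rewrite -lnM ?posrE ?divr_gt0// mulrC divfK// gt_eqF.
apply: (le_trans (ler_sum _ (fun i _ => scaled i))).
rewrite -mulr_sumr -[leRHS]mulr1; apply: ler_wpM2l; first exact: expR_ge0.
rewrite -mulr_sumr exchange_big/= (eq_bigr (fun=> 1)); last first.
  by move=> j _; rewrite -mulr_suml -/(s j) divff ?gt_eqF.
by rewrite sumr_const mulVf ?gt_eqF.
Qed.

End GeometricMeans.

Section MultiplicativeShearer.
Context (R : realType) (E I J : finType).

Definition update (u : {ffun E -> I}) (a : E) (i : I) : {ffun E -> I} :=
  [ffun e => if e == a then i else u e].

(** The marginals of a positive probability measure on words, q D u being the
    mass of the words that agree with u on D.  The third clause makes q D u
    depend on u only through its restriction to D; it lets all marginals take
    arguments of the same type. *)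
Definition consistent_family (q : {set E} -> {ffun E -> I} -> R) : Prop :=
  [/\ forall D u, 0 < q D u,
      forall u, q finset.set0 u = 1,
      forall (D : {set E}) a u i, a \notin D -> q D (update u a i) = q D u &
      forall (D : {set E}) a u, a \notin D -> \sum_i q (a |: D)%SET (update u a i) = q D u].

(** Summing out one coordinate a leaves the marginals of the windows that avoid
    a unchanged; exactly k windows contain a, so that the Hoelder inequality
    with k exponents replaces each of their marginals by the one with a
    removed.  Once all coordinates are summed out, every marginal is 1. *)
Lemma multiplicative_shearer (q : {set E} -> {ffun E -> I} -> R)
    (A : J -> {set E}) (k : nat) :
  consistent_family q -> (0 < k)%N -> (0 < #|I|)%N ->
  (forall e, #|[set j | e \in A j]%SET| = k) ->
  \sum_u expR (k%:R^-1 * \sum_j ln (q (A j) u)) <= 1.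
Proof.
move=> [q0 q1 qupd qsum] k0 I0 Ak.
have := I0 => /card_gt0P[i0 _].
(* S is the set of coordinates being summed out; u0 fixes the others. *)
suff partial (S : {set E}) (u0 : {ffun E -> I}) :
    \sum_(u : {ffun E -> I} | [forall e in ~: S, u e == u0 e]%SET)
      expR (k%:R^-1 * \sum_j ln (q (A j) u)) <=
    expR (k%:R^-1 * \sum_j ln (q (A j :&: ~: S)%SET u0)).
  apply: le_trans (le_trans (partial [set: E]%SET [ffun=> i0]) _).
    rewrite le_eqVlt; apply/orP; left; apply/eqP; apply: eq_bigl => u.
    by apply/esym/forall_inP => e; rewrite finset.inE finset.in_setT.
  rewrite finset.setCT big1 ?mulr0 ?expR0// => j _.
  by rewrite finset.setI0 q1 ln1.
move: {2}#|S| (erefl #|S|) => n; elim: n S u0 => [|n IH] S u0 cardS.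
  move/eqP : cardS; rewrite cards_eq0 => /eqP ->.
  rewrite (big_pred1 u0).
    by rewrite finset.setC0; under [in leRHS]eq_bigr do rewrite finset.setIT.
  move=> u; apply/forall_inP/eqP => [h|->//].
  by apply/ffunP => e; apply/eqP/h; rewrite !finset.inE.
have /card_gt0P[a aS] : (0 < #|S|)%N by rewrite cardS.
pose S' := (S :\ a)%SET.
have cardS' : #|S'| = n by move: cardS; rewrite (cardsD1 a S) aS => -[].
have -> : (~: S = ~: S' :\ a)%SET.
  by apply/finset.setP => e; rewrite !finset.inE; case: eqP => // ->; rewrite aS.
rewrite (partition_big (fun u : {ffun E -> I} => u a) xpredT)//=.
have step i : \sum_(u : {ffun E -> I} |
      [forall e in ~: S' :\ a, u e == u0 e]%SET && (u a == i))
      expR (k%:R^-1 * \sum_j ln (q (A j) u)) <=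
    expR (k%:R^-1 * \sum_j ln (q (A j :&: ~: S')%SET (update u0 a i))).
  apply: le_trans (IH S' (update u0 a i) cardS').
  rewrite le_eqVlt; apply/orP; left; apply/eqP; apply: eq_bigl => u.
  apply/andP/forall_inP => [[/forall_inP h /eqP uai] e eS|h].
    rewrite ffunE; case: (eqVneq e a) => [->|ea]; first exact/eqP.
    by apply: h; rewrite finset.in_setD1 ea.
  have aC : a \in (~: S')%SET by rewrite !finset.inE eqxx.
  split; last by have := h _ aC; rewrite ffunE eqxx.
  apply/forall_inP => e; rewrite finset.in_setD1 => /andP[ea eS].
  by have := h _ eS; rewrite ffunE (negbTE ea).
apply: (le_trans (ler_sum _ (fun i _ => step i))).
pose D := [set j | a \in A j]%SET.
pose B j := (A j :&: (~: S' :\ a))%SET.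
have aB j : a \notin B j by rewrite !finset.inE eqxx andbF.
have splitD (f : J -> R) : \sum_j f j = \sum_(j in D) f j + \sum_(j in ~: D) f j.
  rewrite (bigID (mem D))/=; congr (_ + _).
  by apply: eq_bigl => j; rewrite finset.in_setC.
have inD j : j \in D -> (A j :&: ~: S' = a |: B j)%SET.
  rewrite finset.inE => aA; apply/finset.setP => e; rewrite !finset.inE.
  by case: eqP => [->|]//=; rewrite aA.
have outD j : j \in (~: D)%SET -> (A j :&: ~: S' = B j)%SET.
  rewrite !finset.inE => aA; apply/finset.setP => e; rewrite !finset.inE.
  by case: eqP => [->|]//=; rewrite (negbTE aA).
(* The windows outside D contribute a factor that does not depend on the value
   at a, and the Hoelder inequality applies to those in D. *)
rewrite splitD mulrDr expRD.
under eq_bigr => i _.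
  rewrite splitD mulrDr expRD.
  rewrite [X in _ * expR (_ * X)](eq_bigr (fun j => ln (q (B j) u0))); last first.
    by move=> j jD; rewrite outD// qupd.
  over.
rewrite -mulr_suml ler_wpM2r ?expR_ge0//.
under eq_bigr => i _ do under eq_bigr => j jD do rewrite inD//.
have cardD : #|D| = k by exact: Ak.
rewrite -cardD.
apply: (le_trans (@sum_expR_mean_ln R I J D
  (fun j i => q (a |: B j)%SET (update u0 a i)) _ _ _)) => //.
  by rewrite cardD.
rewrite ler_expR ler_wpM2l ?invr_ge0//.
by apply: ler_sum => j jD; rewrite qsum.
Qed.

End MultiplicativeShearer.

(** * Code lengths and entropy *)

Section Gibbs.
Context (R : realType).

(** By ln z <= z - 1 at z = q j / p j, the code lengths - ln (q j) of a
    subprobability q are on average no shorter than the entropy of p. *)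
Lemma gibbs_inequality (J : finType) (p q : J -> R) :
  (forall j, 0 <= p j) -> \sum_j p j = 1 ->
  (forall j, 0 < q j) -> \sum_j q j <= 1 ->
  - \sum_j p j * ln (p j) <= \sum_j p j * - ln (q j).
Proof.
move=> p0 p1 q0 q1; rewrite -subr_ge0 opprK -big_split/=.
have termwise j : p j - q j <= p j * - ln (q j) + p j * ln (p j).
  have := p0 j; rewrite le_eqVlt => /predU1P[<-|pj].
    by rewrite !mul0r addr0 sub0r oppr_le0 ltW.
  have : ln (q j / p j) <= q j / p j - 1.
    by rewrite -{1}[q j / p j](subrKC 1) le_ln1Dx// ltrBrDl subrr divr_gt0.
  rewrite ln_div ?posrE// -(ler_pM2l pj) !mulrBr mulr1 mulrCA divff ?gt_eqF//.
  by rewrite mulr1; lra.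
apply: le_trans (ler_sum _ (fun j _ => termwise j)).
by rewrite sumrB p1 subr_ge0.
Qed.

Lemma entropy_le_ln_card (J : finType) (p : J -> R) :
  (forall j, 0 <= p j) -> \sum_j p j = 1 ->
  - \sum_j p j * ln (p j) <= ln (#|J|%:R).
Proof.
move=> p0 p1.
have J0 : (0 < #|J|)%N.
  rewrite lt0n; apply: contra_eqN p1 => /eqP/card0_eq J0.
  by rewrite big_pred0 1?eq_sym ?oner_eq0// => j; have := J0 j.
have J0R : 0 < #|J|%:R :> R by rewrite ltr0n.
apply: (le_trans (@gibbs_inequality J p (fun=> #|J|%:R^-1) p0 p1 _ _)).
- by move=> _; rewrite invr_gt0.
- by rewrite /= sumr_const -[_ *+ _]mulr_natl divff// gt_eqF.
- by rewrite -mulr_suml p1 mul1r lnV ?posrE// opprK.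
Qed.

(** Kraft's inequality bounds the number of words with short codes. *)
Lemma card_le_expR (J : finType) (f : J -> R) (a : R) :
  \sum_j expR (- f j) <= 1 -> #|[set j | f j <= a]%SET|%:R <= expR a.
Proof.
move=> f1; rewrite -[leLHS](@mulfK _ (expR (- a))) ?gt_eqF ?expR_gt0//.
rewrite expRN invrK -[leRHS]mul1r; apply: ler_wpM2r; first exact: expR_ge0.
apply: le_trans f1; rewrite (bigID (mem [set j | f j <= a]%SET))/=.
rewrite -[leLHS]addr0 lerD//; last first.
  by apply: sumr_ge0 => j _; exact: expR_ge0.
rewrite mulr_natl -expRN -sumr_const; apply: ler_sum => j.
by rewrite finset.inE ler_expR lerN2.
Qed.

End Gibbs.

Section HammingBalls.
Context (R : realType) (E I : finType).
Implicit Types (u c : {ffun E -> I}).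

(** Gibbs' inequality for an explicit code: half of the mass of q is uniform on
    all words, the other half is spread over the M centres, each centre c i
    being blurred by letters that are independently correct with probability
    1 - alpha.  A word of C is close to a centre, which makes its code about
    ln M long, up to a small multiple of |E|; a word outside C costs at most
    |E| ln |I|, and C has mass at least 1 - eps. *)
Lemma entropy_le_covering (M : nat) (c : 'I_M -> {ffun E -> I})
    (C : {set {ffun E -> I}}) (eps alpha : R) (p : {ffun E -> I} -> R) :
  (0 < M)%N -> (0 < #|I|)%N -> 0 <= eps -> 0 < alpha < 1 ->
  (forall u, 0 <= p u) -> \sum_u p u = 1 ->
  (forall u, u \in C -> exists i,
     \sum_e (u e != c i e)%:R <= eps * #|E|%:R) ->
  1 - eps <= \sum_(u in C) p u ->
  - \sum_u p u * ln (p u) <=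
  ln (2 * M%:R) + #|E|%:R * (- ln (1 - alpha) + eps * ln (#|I|%:R / alpha)
     + eps * ln #|I|%:R).
Proof.
move=> M0 I0 eps0 /andP[alpha0 alpha1] p0 p1 nearC pC.
have M0R : 0 < M%:R :> R by rewrite ltr0n.
have I0R : 0 < #|I|%:R :> R by rewrite ltr0n.
have I1R : 1 <= #|I|%:R :> R by rewrite ler1n.
have alphaI : 0 < alpha / #|I|%:R by rewrite divr_gt0.
pose b (i j : I) : R := if i == j then 1 - alpha else alpha / #|I|%:R.
have b0 i j : 0 < b i j by rewrite /b; case: ifP => // _; rewrite subr_gt0.
have b1 j : \sum_i b i j <= 1.
  rewrite (bigD1 j)//= {1}/b eqxx -lerBrDl opprB subrKC.
  apply: (@le_trans _ _ (\sum_(i : I) alpha / #|I|%:R)); last first.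
    by rewrite sumr_const -[leLHS]mulr_natr divfK ?gt_eqF.
  rewrite [leRHS](bigD1 j)//= -[leLHS]add0r lerD ?(ltW alphaI)//.
  by apply: ler_sum => i ij; rewrite /b (negbTE ij).
pose near i u : R := \prod_e b (u e) (c i e).
have near0 i u : 0 < near i u by apply: prodr_gt0.
have near1 i : \sum_u near i u <= 1.
  rewrite -(bigA_distr_bigA (fun e j => b j (c i e))) /=.
  by apply: prodr_ile1 => e _; rewrite b1 sumr_ge0// => j _; exact: ltW.
pose q u := 2^-1 * (M%:R^-1 * \sum_i near i u)
  + 2^-1 * #|{ffun E -> I}|%:R^-1.
have W0 : 0 < #|{ffun E -> I}|%:R :> R by rewrite card_ffun ltr0n expn_gt0 I0.
have q0 u : 0 < q u.
  rewrite ltr_wpDl// ?mulr_gt0 ?invr_gt0// !mulr_ge0 ?invr_ge0//.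
  by apply: sumr_ge0 => i _; exact: ltW.
have q1 : \sum_u q u <= 1.
  have uniform : \sum_(u : {ffun E -> I}) #|{ffun E -> I}|%:R^-1 = 1 :> R.
    by rewrite sumr_const -[LHS]mulr_natl divff ?gt_eqF.
  rewrite big_split/= -!mulr_sumr uniform exchange_big/= mulr1.
  suff : M%:R^-1 * (\sum_j \sum_i near j i) <= 1 by lra.
  rewrite ler_pdivrMl// mulr1.
  apply: (le_trans (ler_sum _ (fun i _ => near1 i))).
  by rewrite sumr_const card_ord.
have nearE i u : near i u = expR (\sum_e ln (b (u e) (c i e))).
  by rewrite expR_sum; apply: eq_bigr => e _; rewrite lnK ?posrE.
have lnI : 0 <= ln #|I|%:R :> R by exact: ln_ge0.
have ln1a : ln (1 - alpha) <= 0 by apply: ln_le0; rewrite gerBl ltW.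
have lnIa : 0 <= ln (#|I|%:R / alpha).
  by apply: ln_ge0; rewrite ler_pdivlMr// mul1r (le_trans (ltW alpha1)).
have E0 : 0 <= #|E|%:R :> R by [].
have ln2M : 0 <= ln (2 * M%:R) :> R.
  by apply: ln_ge0; rewrite mulr_ege1// ?ler1n// ler1n.
have bln i j : ln (1 - alpha) - (i != j)%:R * ln (#|I|%:R / alpha) <= ln (b i j).
  rewrite /b; case: eqP => _ /=; first by rewrite mul0r subr0.
  rewrite mul1r -[in leRHS]invf_div lnV ?posrE ?divr_gt0//.
  by move: ln1a; lra.
have code u : - ln (q u) <= ln (2 * M%:R)
    + #|E|%:R * (- ln (1 - alpha) + eps * ln (#|I|%:R / alpha))
    + (u \notin C)%:R * (#|E|%:R * ln #|I|%:R).
  have lnM0 : 0 <= ln M%:R :> R by rewrite ln_ge0// ler1n.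
  have lnle (x y : R) : 0 < x -> x <= y -> - ln y <= - ln x.
    by move=> x0 xy; rewrite lerN2 ler_ln ?posrE// (lt_le_trans x0).
  have -> : ln (2 * M%:R : R) = ln 2 + ln M%:R by rewrite lnM ?posrE.
  have [uC|uC] := boolP (u \in C); last first.
    have : 2^-1 * #|{ffun E -> I}|%:R^-1 <= q u.
      rewrite lerDr !mulr_ge0 ?invr_ge0//.
      by apply: sumr_ge0 => i _; exact: ltW.
    move=> /lnle; rewrite -invfM lnV ?posrE ?mulr_gt0// opprK => qu.
    rewrite mul1r (le_trans (qu _)) ?invr_gt0 ?mulr_gt0//.
    rewrite lnM ?posrE// card_ffun natrX lnXn ?posrE// -mulr_natl.
    have : 0 <= #|E|%:R * (- ln (1 - alpha) + eps * ln (#|I|%:R / alpha)).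
      by rewrite mulr_ge0// addr_ge0 ?oppr_ge0// mulr_ge0.
    by lra.
  rewrite mul0r addr0; have [i ci] := nearC u uC.
  have : 2^-1 * (M%:R^-1 * near i u) <= q u.
    rewrite ler_wpDr ?mulr_ge0 ?invr_ge0//.
    rewrite ler_wpM2l ?invr_ge0//.
    rewrite ler_wpM2l ?invr_ge0// (bigD1 i)//= lerDl.
    by apply: sumr_ge0 => j _; exact: ltW.
  move=> /lnle; rewrite mulrA -invfM => qu.
  rewrite (le_trans (qu _)) ?mulr_gt0 ?invr_gt0 ?mulr_gt0//.
  rewrite nearE lnM ?posrE ?expR_gt0 ?invr_gt0 ?mulr_gt0//.
  rewrite lnV ?posrE ?mulr_gt0// expRK lnM ?posrE//.
  rewrite opprD opprK lerD2l.
  apply: le_trans (_ : - \sum_e (ln (1 - alpha) -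
      (u e != c i e)%:R * ln (#|I|%:R / alpha)) <= _).
    by rewrite lerN2; apply: ler_sum => e _; exact: bln.
  rewrite sumrB -mulr_suml.
  have -> : \sum_(e : E) ln (1 - alpha) = #|E|%:R * ln (1 - alpha).
    by rewrite sumr_const -[LHS]mulr_natl.
  by have := ler_wpM2r lnIa ci; lra.
apply: (le_trans (@gibbs_inequality R _ p q p0 p1 q0 q1)).
apply: (le_trans (ler_sum _ (fun u _ => ler_wpM2l (p0 u) (code u)))).
under eq_bigr do rewrite mulrDr [X in _ + X]mulrA.
rewrite big_split/= -!mulr_suml p1 mul1r.
have rare : \sum_u p u * (u \notin C)%:R <= eps.
  suff : \sum_(u in C) p u + \sum_u p u * (u \notin C)%:R = 1 by lra.
  rewrite -[RHS]p1 [RHS](bigID (mem C))/=; congr (_ + _).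
  rewrite [RHS]big_mkcond/=.
  by apply: eq_bigr => u _; case: (u \in C); rewrite ?mulr0 ?mulr1.
have := ler_wpM2r (mulr_ge0 E0 lnI) rare; lra.
Qed.

End HammingBalls.

Section Marginals.
Context (R : realType) (E I : finType).
Implicit Types (p : {ffun E -> I} -> R) (D : {set E}) (u v : {ffun E -> I}).

Definition agree D u v := [forall e in D, v e == u e].

Definition marginal p D u : R := \sum_(v | agree D u v) p v.

(** The marginal of the mixture of p with the uniform measure on words. *)
Definition smoothed_marginal (eta : R) p D u : R :=
  (1 - eta) * marginal p D u + eta * (#|I|%:R^-1) ^+ #|D|.

Lemma agree_update D a u i v : a \notin D -> agree D (update u a i) v = agree D u v.
Proof.
move=> aD; apply: eq_forallb_in => e eD; rewrite ffunE ifN//.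
by apply: contraNneq aD => <-.
Qed.

Lemma agree_setU1 D a u i v : a \notin D ->
  agree (a |: D)%SET (update u a i) v = agree D u v && (v a == i).
Proof.
move=> aD; rewrite -(agree_update u i v aD); apply/forall_inP/andP => [h|[/forall_inP h vi] e].
  split; last by have := h a (finset.setU11 _ _); rewrite ffunE eqxx.
  by apply/forall_inP => e eD; apply: h; exact: finset.setU1r.
by rewrite finset.in_setU1 => /predU1P[->|]; [rewrite ffunE eqxx|exact: h].
Qed.

Lemma smoothed_marginal_consistent (eta : R) p : (0 < #|I|)%N ->
  (forall u, 0 <= p u) -> \sum_u p u = 1 -> 0 < eta < 1 ->
  consistent_family (smoothed_marginal eta p).
Proof.
move=> I0 p0 p1 /andP[eta0 eta1].
have I0R : 0 < #|I|%:R :> R by rewrite ltr0n.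
split.
- move=> D u; rewrite ltr_wpDl//; last by rewrite mulr_gt0// exprn_gt0// invr_gt0.
  by rewrite mulr_ge0 ?subr_ge0 ?(ltW eta1)// sumr_ge0.
- move=> u; rewrite /smoothed_marginal /marginal cards0 expr0 mulr1.
  rewrite (eq_bigl xpredT) ?p1 ?mulr1 ?subrK// => v.
  by apply/forall_inP => e; rewrite finset.in_set0.
- move=> D a u i aD; rewrite /smoothed_marginal /marginal; congr (_ * _ + _).
  by apply: eq_bigl => v; rewrite agree_update.
- move=> D a u aD; rewrite /smoothed_marginal big_split/= -!mulr_sumr; congr (_ * _ + _ * _).
    rewrite /marginal [RHS](partition_big (fun v : {ffun E -> I} => v a) xpredT)//=.
    by apply: eq_bigr => i _; apply: eq_bigl => v; rewrite agree_setU1.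
  by rewrite sumr_const cardsU1 aD add1n exprS -[LHS]mulr_natl mulVKf// gt_eqF.
Qed.

End Marginals.

(** * Integrals of bounded measurable functions *)

Section BoundedMeasurable.
Context (R : realType) (d : measure_display) (X : measurableType d).
Implicit Types f g : X -> R.

Definition bounded_measurable f :=
  measurable_fun [set: X] f /\ exists M, forall x, `|f x| <= M.

Lemma bounded_measurable_cst c : bounded_measurable (fun=> c).
Proof. by split => //; exists `|c|. Qed.

Lemma bounded_measurableD f g : bounded_measurable f -> bounded_measurable g ->
  bounded_measurable (fun x => f x + g x).
Proof.
move=> [mf [M fM]] [mg [N gN]]; split; first exact: measurable_funD.
by exists (M + N) => x; rewrite (le_trans (ler_normD _ _))// lerD.
Qed.

Lemma bounded_measurableM f g : bounded_measurable f -> bounded_measurable g ->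
  bounded_measurable (fun x => f x * g x).
Proof.
move=> [mf [M fM]] [mg [N gN]]; split; first exact: measurable_funM.
by exists (M * N) => x; rewrite normrM ler_pM.
Qed.

Lemma bounded_measurableZ c f : bounded_measurable f ->
  bounded_measurable (fun x => c * f x).
Proof. exact: bounded_measurableM (bounded_measurable_cst c). Qed.

Lemma bounded_measurableB f g : bounded_measurable f -> bounded_measurable g ->
  bounded_measurable (fun x => f x - g x).
Proof.
move=> bf bg; have := bounded_measurableD bf (bounded_measurableZ (-1) bg).
by under [X in bounded_measurable X -> _]eq_fun do rewrite mulN1r.
Qed.

Lemma bounded_measurableX f : bounded_measurable f ->
  bounded_measurable (fun x => f x ^+ 2).
Proof. by move=> bf; have := bounded_measurableM bf bf. Qed.

Lemma bounded_measurable_norm f : bounded_measurable f ->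
  bounded_measurable (fun x => `|f x|).
Proof.
move=> [mf [M fM]]; split; first exact: measurableT_comp.
by exists M => x; rewrite normr_id.
Qed.

Lemma bounded_measurable_sum (J : Type) (s : seq J) (f : J -> X -> R) :
  (forall j, bounded_measurable (f j)) ->
  bounded_measurable (fun x => \sum_(j <- s) f j x).
Proof.
move=> bf; elim: s => [|j s IH].
  by under eq_fun do rewrite big_nil; exact: bounded_measurable_cst.
by under eq_fun do rewrite big_cons; exact: bounded_measurableD.
Qed.

Lemma bounded_measurable_comp (h : X -> X) f : measurable_fun [set: X] h ->
  bounded_measurable f -> bounded_measurable (f \o h).
Proof.
move=> mh [mf [M fM]]; split; first exact: measurableT_comp.
by exists M => x /=.
Qed.

Lemma measurable_superlevel f (c : R) : measurable_fun [set: X] f ->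
  measurable [set x | c <= f x].
Proof.
move=> mf; rewrite (_ : [set _ | _] = f @^-1` `[c, +oo[%classic).
  by rewrite -[X in measurable X]setTI; exact: mf.
by apply/seteqP; split => x /=; rewrite in_itv/= andbT.
Qed.

Lemma measurable_sublevel f (c : R) : measurable_fun [set: X] f ->
  measurable [set x | f x <= c].
Proof.
move=> mf; rewrite (_ : [set _ | _] = f @^-1` `]-oo, c]%classic).
  by rewrite -[X in measurable X]setTI; exact: mf.
by apply/seteqP; split => x /=; rewrite in_itv.
Qed.

Context (mu : probability X R).

Lemma bounded_measurable_integrable f : bounded_measurable f ->
  mu.-integrable [set: X] (EFin \o f).
Proof.
move=> [mf [M fM]]; apply: measurable_bounded_integrable => //.
  by apply: le_lt_trans (probability_le1 mu measurableT) (ltry 1).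
exists M; split; first by rewrite num_real.
by move=> x Mx y _ /=; rewrite (le_trans (fM y))// ltW.
Qed.
Local Notation intb := bounded_measurable_integrable.

Lemma EFin_Rintegral f : bounded_measurable f ->
  (\int[mu]_x f x)%:E = (\int[mu]_x (f x)%:E)%E.
Proof.
move=> bf; rewrite /Rintegral fineK//.
exact: integrable_fin_num (bounded_measurable_integrable bf).
Qed.

Lemma mean_cst c : \int[mu]_x c = c.
Proof.
transitivity (c * fine (mu [set: X])); first exact: Rintegral_cst.
by rewrite probability_setT mulr1.
Qed.

Lemma meanD f g : bounded_measurable f -> bounded_measurable g ->
  \int[mu]_x (f x + g x) = \int[mu]_x f x + \int[mu]_x g x.
Proof. by move=> bf bg; rewrite RintegralD//; exact: intb. Qed.

Lemma meanB f g : bounded_measurable f -> bounded_measurable g ->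
  \int[mu]_x (f x - g x) = \int[mu]_x f x - \int[mu]_x g x.
Proof. by move=> bf bg; rewrite RintegralB//; exact: intb. Qed.

Lemma meanZ c f : bounded_measurable f ->
  \int[mu]_x (c * f x) = c * \int[mu]_x f x.
Proof. by move=> bf; rewrite RintegralZl//; exact: intb. Qed.

Lemma mean_sum (J : Type) (s : seq J) (f : J -> X -> R) :
  (forall j, bounded_measurable (f j)) ->
  \int[mu]_x (\sum_(j <- s) f j x) = \sum_(j <- s) \int[mu]_x f j x.
Proof.
move=> bf; elim: s => [|j s IH].
  by rewrite big_nil; under eq_Rintegral do rewrite big_nil; exact: mean_cst.
rewrite big_cons -IH -meanD//; last exact: bounded_measurable_sum.
by apply: eq_Rintegral => x _; rewrite big_cons.
Qed.

Lemma le_mean f g : bounded_measurable f -> bounded_measurable g ->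
  (forall x, f x <= g x) -> \int[mu]_x f x <= \int[mu]_x g x.
Proof. by move=> bf bg fg; apply: le_Rintegral => //; exact: intb. Qed.

Lemma markov_bounded f (c : R) : bounded_measurable f -> (forall x, 0 <= f x) ->
  0 < c -> (mu [set x | (c <= f x)%R] <= (c^-1 * \int[mu]_x f x)%:E)%E.
Proof.
move=> bf f0 c0; have [mf _] := bf.
set A := [set x | _].
have mA : measurable A by exact: measurable_superlevel.
rewrite mulrC EFinM lee_pdivlMr//.
rewrite muleC EFin_Rintegral// -integral_cst// integral_mkcond.
apply: ge0_le_integral => //=.
- by move=> x _; rewrite /patch; case: ifP => // _; rewrite lee_fin ltW.
- by apply/(measurable_restrictT _ mA).
- exact/measurable_EFinP.
- move=> x _; rewrite /patch; case: ifPn => [/set_mem//|_].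
  by rewrite lee_fin.
Qed.

Lemma mean_invariant (h : X -> X) f : measurable_fun [set: X] h ->
  (forall A, measurable A -> mu (h @^-1` A) = mu A) -> bounded_measurable f ->
  \int[mu]_x f (h x) = \int[mu]_x f x.
Proof.
move=> mh hinv bf; rewrite /Rintegral; congr fine.
have [mf _] := bf.
have := @integral_pushforward _ _ _ _ R h mh mu [set: X] (EFin \o f).
rewrite preimage_setT => <-//.
- by apply: eq_measure_integral => A mA _; exact: hinv.
- exact/measurable_EFinP.
- exact: (bounded_measurable_integrable (bounded_measurable_comp mh bf)).
Qed.

End BoundedMeasurable.

Section SummableSquares.
Context (R : realType) (d : measure_display) (X : measurableType d)
  (mu : probability X R).

Lemma sum_halves (n : nat) : \sum_(0 <= m < n) (2^-1 : R) ^+ m <= 2.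
Proof.
have -> : \sum_(0 <= m < n) (2^-1 : R) ^+ m = 2 - 2 * 2^-1 ^+ n.
  elim: n => [|n IH]; first by rewrite big_nil expr0 mulr1 subrr.
  by rewrite big_nat_recr//= IH exprS; field.
by rewrite gerBl mulr_ge0// exprn_ge0// invr_ge0.
Qed.

(** A substitute for the Cauchy-Schwarz inequality: |h| <= q + h^2 / q. *)
Lemma mean_norm_le_square (h : X -> R) (q : R) : bounded_measurable h -> 0 < q ->
  \int[mu]_x `|h x| <= q + q^-1 * \int[mu]_x (h x ^+ 2).
Proof.
move=> bh q0; have b2 := bounded_measurableX bh.
rewrite -{1}(mean_cst mu q) -meanZ// -meanD//;
  [|exact: bounded_measurable_cst|exact: bounded_measurableZ].
apply: le_mean.
- exact: bounded_measurable_norm.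
- by apply: bounded_measurableD; [exact: bounded_measurable_cst|exact: bounded_measurableZ].
move=> x; rewrite -real_normK ?num_real//; set y := `|h x|.
have y0 : 0 <= y by exact: normr_ge0.
have [yq|qy] := leP y q.
  by rewrite (le_trans yq)// lerDl mulr_ge0 ?sqr_ge0// invr_ge0 ltW.
have : y <= q^-1 * y ^+ 2.
  by rewrite ler_pdivlMl// expr2 ler_wpM2r// ltW.
lra.
Qed.

(** With q = 2^-m, the bound 4^-m on the second moment of h m makes the first
    moments summable, so that the sum of the |h m| has a finite integral. *)
Lemma ae_cvg_series_norm (h : nat -> X -> R) (C : R) :
  (forall m, bounded_measurable (h m)) -> 0 <= C ->
  (forall m, \int[mu]_x (h m x ^+ 2) <= C * 4^-1 ^+ m) ->
  \forall x \ae mu, cvgn (series (fun m => `|h m x|)).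
Proof.
move=> bh C0 hC.
have mh m : measurable_fun [set: X] (fun x => `|h m x|%:E).
  by apply/measurable_EFinP; case: (bounded_measurable_norm (bh m)).
have normh m : \int[mu]_x `|h m x| <= (1 + C) * 2^-1 ^+ m.
  have q0 : 0 < (2^-1 : R) ^+ m by rewrite exprn_gt0// invr_gt0.
  apply: (le_trans (mean_norm_le_square (bh m) q0)).
  rewrite mulrDl mul1r lerD2l ler_pdivrMl// mulrCA -expr2 -exprM mulnC exprM.
  by rewrite (_ : 2^-1 ^+ 2 = 4^-1 :> R)//; field.
have total : (\int[mu]_x (\sum_(0 <= m <oo) `|h m x|%:E) <= ((1 + C) * 2)%:E)%E.
  rewrite integral_nneseries//; apply: lime_le.
    by apply: is_cvg_nneseries => n _ _; exact: integral_ge0.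
  apply: nearW => n.
  rewrite (eq_bigr (fun m => (\int[mu]_x `|h m x|)%:E)); last first.
    by move=> m _; rewrite EFin_Rintegral//; exact: bounded_measurable_norm.
  rewrite sumEFin lee_fin (le_trans (ler_sum _ (fun m _ => normh m)))//.
  by rewrite -mulr_sumr ler_wpM2l ?sum_halves// addr_ge0.
have intS : mu.-integrable [set: X] (fun x => \sum_(0 <= m <oo) `|h m x|%:E)%E.
  apply/integrableP; split.
    by apply: ge0_emeasurable_sum => // n x _ _.
  under eq_integral do rewrite gee0_abs ?nneseries_ge0//.
  by rewrite (le_lt_trans total)// ltry.
apply: filterS (integrable_ae measurableT intS) => x /(_ I) finx.
apply: nondecreasing_is_cvgn.
  by apply: nondecreasing_series => n _ _.
exists (fine (\sum_(0 <= m <oo) `|h m x|%:E)%E) => _ [n _ <-].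
rewrite -lee_fin fineK// /series/= -sumEFin.
exact: nneseries_lim_ge.
Qed.

End SummableSquares.

(** * The mean ergodic theorem for amenable groups *)

Section InvariantFunctions.
Context (R : realType) (G : groupType) (Gcountable : countable [set: G])
  (d : measure_display) (X : measurableType d)
  (mu : probability X R) (T : G -> X -> X)
  (Tsystem : mp_system mu T) (Tergodic : ergodic mu T).

(** Ergodicity speaks of strictly invariant sets, while f is invariant only up
    to null sets; the intersection of all translates of a level set is strictly
    invariant and differs from it by a null set, since G is countable. *)
Lemma ergodic_level_sets (f : X -> R) (t : R) : measurable_fun [set: X] f ->
  (forall g, \forall x \ae mu, f (T g x) = f x) ->
  mu [set x | f x <= t] = 0%E \/ mu [set x | f x <= t] = 1%E.
Proof.
move=> mf finv; have [_ mT Tinv T1 TM] := Tsystem.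
set A := [set x | _].
have mA : measurable A by exact: measurable_sublevel.
pose B := \bigcap_(g in [set: G]) (T g @^-1` A).
have mTA g : measurable (T g @^-1` A) by rewrite -[X in measurable X]setTI; exact: mT.
have mB : measurable B.
  rewrite /B -[X in measurable X]setCK setC_bigcap; apply: measurableC.
  by apply: countable_bigcupT_measurable => // g; exact: measurableC.
have BE g : T g @^-1` B = B.
  apply/seteqP; split => x /= Bx h _ /=.
    have := Bx (h * g^-1)%g I; rewrite /= -TM -mulgA mulVg mulg1 //.
  by have := Bx (h * g)%g I; rewrite /= TM.
suff -> : mu A = mu B by exact: Tergodic.
have negl g : mu.-negligible (A `\` T g @^-1` A).
  have [N [mN N0 subN]] := finv g; exists N; split => //.
  move=> x [Ax nAx]; apply: subN => /= fx; apply: nAx.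
  by rewrite /A /= fx.
have BA : B `<=` A by move=> x /(_ 1%g I); rewrite /= T1.
have /countable_injP[code code_inj] := Gcountable.
have : mu.-negligible (A `\` B).
  apply: (@negligibleS _ _ _ _ (\bigcup_n
    [set x | exists g, code g = n /\ (A `\` T g @^-1` A) x])).
    move=> x [Ax nBx]; have [g nAg] : exists g, ~ A (T g x).
      by apply: contrapT => h; apply: nBx => g _; apply: contrapT => ?; apply: h; exists g.
    by exists (code g) => //; exists g.
  apply: negligible_bigcup => n.
  have [[g gn]|no] := pselect (exists g, code g = n).
    apply: negligibleS (negl g) => x [h [hn]].
    by rewrite (code_inj h g) ?inE// gn.
  rewrite (_ : [set _ | _] = set0); first exact: negligible_set0.
  by apply/seteqP; split => x // [g [gn _]]; apply: no; exists g.
move=> /(measure_negligible (measurableD mA mB)) AB0.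
have -> : A = B `|` (A `\` B).
  by apply/seteqP; split => [x Ax|x [/BA|[]]//]; have [|] := pselect (B x); [left|right].
rewrite measureU//; last 2 first.
- exact: measurableD.
- by apply/seteqP; split => x // [Bx [_ /(_ Bx)]].
by rewrite AB0 adde0.
Qed.

(** The convex combinations of translates of f with dyadic weights: closure under
    midpoints is all that the parallelogram identity needs, and facts about them
    follow by induction. *)
Inductive translate_mean (f : X -> R) : (X -> R) -> Prop :=
| translate_mean_base g : translate_mean f (fun x => f (T g x))
| translate_mean_mid a b : translate_mean f a -> translate_mean f b ->
    translate_mean f (fun x => 2^-1 * (a x + b x)).

Lemma translate_mean_comp f a h : translate_mean f a ->
  translate_mean f (fun x => a (T h x)).
Proof.
have [_ _ _ _ TM] := Tsystem.
elim => [g|b c _ IHb _ IHc]; last exact: translate_mean_mid.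
rewrite (_ : (fun x => _) = (fun x => f (T (g * h)%g x))).
  exact: translate_mean_base.
by apply/funext => x; rewrite TM.
Qed.

Lemma translate_mean_bounded f a : bounded_measurable f ->
  translate_mean f a -> bounded_measurable a.
Proof.
have [_ mT _ _ _] := Tsystem => bf; elim => [g|b c _ IHb _ IHc].
  exact: bounded_measurable_comp.
by apply: bounded_measurableZ; exact: bounded_measurableD.
Qed.

Lemma translate_mean_le f a M : (forall x, `|f x| <= M) ->
  translate_mean f a -> forall x, `|a x| <= M.
Proof.
move=> fM; elim => [g|b c _ IHb _ IHc] x; first exact: fM.
have := ler_normD (b x) (c x); have := IHb x; have := IHc x.
rewrite normrM ger0_norm ?invr_ge0// ler_pdivrMl//; lra.
Qed.

Lemma translate_mean_mean f a : bounded_measurable f ->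
  translate_mean f a -> \int[mu]_x a x = \int[mu]_x f x.
Proof.
have [_ mT Tinv _ _] := Tsystem => bf; elim => [g|b c tb IHb tc IHc].
  exact: (mean_invariant (mT g) (Tinv g) bf).
have bb := translate_mean_bounded bf tb; have bc := translate_mean_bounded bf tc.
by rewrite meanZ ?meanD ?IHb ?IHc//; [field|exact: bounded_measurableD].
Qed.

(** The parallelogram identity: two means whose norms are nearly minimal are close
    to each other, because the norm of their midpoint is not below the minimum. *)
Lemma translate_mean_parallelogram f a b c q : bounded_measurable f ->
  (forall a', translate_mean f a' -> c <= \int[mu]_x (a' x ^+ 2)) ->
  translate_mean f a -> translate_mean f b ->
  \int[mu]_x (a x ^+ 2) <= c + q -> \int[mu]_x (b x ^+ 2) <= c + q ->
  \int[mu]_x ((a x - b x) ^+ 2) <= 4 * q.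
Proof.
move=> bf cmin ta tb aq bq.
have ba := translate_mean_bounded bf ta; have bb := translate_mean_bounded bf tb.
have bm := translate_mean_bounded bf (translate_mean_mid ta tb).
have := cmin _ (translate_mean_mid ta tb).
have -> : \int[mu]_x ((a x - b x) ^+ 2) =
  2 * \int[mu]_x (a x ^+ 2) + 2 * \int[mu]_x (b x ^+ 2)
  - 4 * \int[mu]_x ((2^-1 * (a x + b x)) ^+ 2).
  rewrite -!meanZ; try exact: bounded_measurableX.
  rewrite -meanD -?meanB; try by
    do ?[apply: bounded_measurableD|apply: bounded_measurableZ
        |apply: bounded_measurableX].
  by apply: eq_Rintegral => x _; field.
lra.
Qed.

End InvariantFunctions.

Lemma ae_le_integral (R : realType) (d : measure_display) (X : measurableType d)
    (mu : {measure set X -> \bar R}) (f g : X -> \bar R) :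
  mu.-integrable [set: X] f -> mu.-integrable [set: X] g ->
  (\forall x \ae mu, f x <= g x)%E ->
  (\int[mu]_x f x <= \int[mu]_x g x)%E.
Proof.
move=> intf intg [N [mN N0 fgN]].
rewrite (negligible_integral mN)// [leRHS](negligible_integral mN)//.
have mTN : measurable ([set: X] `\` N) by exact: measurableD.
apply: le_integral => //.
- by apply: integrableS intf.
- by apply: integrableS intg.
- by move=> x /set_mem[_ nN]; apply: contrapT => nfg; exact: nN (fgN x nfg).
Qed.

Lemma sum_fset_diff (R : realType) (K : choiceType) (A B : {fset K})
    (f : K -> R) (M : R) :
  (forall x, `|f x| <= M) ->
  `|\sum_(x <- A) f x - \sum_(x <- B) f x| <=
  M * (#|` A|%:R + #|` B|%:R - 2 * #|` A `&` B|%fset%:R).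
Proof.
move=> fM.
have split1 (C D : {fset K}) : \sum_(x <- C) f x =
    \sum_(x <- (C `&` D)%fset) f x + \sum_(x <- (C `\` D)%fset) f x.
  rewrite (big_fsetID _ (mem D))/=; congr (_ + _).
    by apply: eq_fbigl => x; rewrite !inE.
  by apply: eq_fbigl => x; rewrite !inE andbC.
have sumM (C : {fset K}) : `|\sum_(x <- C) f x| <= M * #|` C|%:R.
  rewrite (le_trans (ler_norm_sum _ _ _))// (le_trans (ler_sum _ (fun x _ => fM x)))//.
  by rewrite big_const_seq count_predT iter_addr_0 mulr_natr.
rewrite (split1 A B) (split1 B A) fsetIC opprD addrACA subrr add0r.
rewrite (le_trans (ler_normB _ _))// (le_trans (lerD (sumM _) (sumM _)))//.
rewrite -mulrDr le_eqVlt; apply/orP; left; apply/eqP; congr (_ * _).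
rewrite !cardfsD !natrB ?fsubset_leq_card ?fsubsetIl// (fsetIC A B).
by ring.
Qed.

Section MeanErgodic.
Context (R : realType) (G : groupType) (Gcountable : countable [set: G])
  (d : measure_display) (X : measurableType d)
  (mu : probability X R) (T : G -> X -> X)
  (Tsystem : mp_system mu T) (Tergodic : ergodic mu T).

(** Let psi be a sequence of means whose L2 norms tend to the infimum quickly.  By
    the parallelogram identity psi m.+1 - psi m and psi m o T^g - psi m are
    square summable, so psi converges almost everywhere to an invariant function
    F.  By ergodicity F is almost everywhere constant, and this constant is 0
    because all psi m have integral 0; by dominated convergence the norms tend
    to 0 as well. *)
Lemma translate_mean_small (f : X -> R) (e : R) : bounded_measurable f -> \int[mu]_x f x = 0 ->
  0 < e -> exists a, translate_mean T f a /\ \int[mu]_x (a x ^+ 2) < e.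
Proof.
move=> bf f0 e0; apply: contrapT => noa.
have [_ mT Tinv _ _] := Tsystem.
have lbe a : translate_mean T f a -> e <= \int[mu]_x (a x ^+ 2).
  by move=> ta; rewrite leNgt; apply/negP => ae; apply: noa; exists a.
pose S := [set s | exists a, translate_mean T f a /\ s = \int[mu]_x (a x ^+ 2)].
have infS : has_inf S.
  split; last by exists e => _ [a [ta ->]]; exact: lbe.
  by exists (\int[mu]_x (f (T 1%g x) ^+ 2)), (fun x => f (T 1%g x)); split => //;
    exact: translate_mean_base.
pose c := inf S.
have cmin a : translate_mean T f a -> c <= \int[mu]_x (a x ^+ 2).
  by move=> ta; apply: ge_inf; [case: infS|exists a].
have q0 m : 0 < (4^-1 : R) ^+ m by rewrite exprn_gt0// invr_gt0.
have /choice[psi psiP] m : exists a, translate_mean T f a /\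
    \int[mu]_x (a x ^+ 2) <= c + 4^-1 ^+ m.
  have [_ [a [ta ->]] /ltW ac] := inf_adherent (q0 m) infS.
  by exists a.
have tpsi m : translate_mean T f (psi m) by case: (psiP m).
have psic m : \int[mu]_x (psi m x ^+ 2) <= c + 4^-1 ^+ m by case: (psiP m).
have bpsi m := translate_mean_bounded Tsystem bf (tpsi m).
have [M fM] : exists M, forall x, `|f x| <= M by case: bf.
have psiM m x : `|psi m x| <= M := translate_mean_le fM (tpsi m) x.
have cvgpsi : \forall x \ae mu, cvgn (fun m => psi m x).
  have : \forall x \ae mu, cvgn (series (fun m => `|psi m.+1 x - psi m x|)).
    apply: (@ae_cvg_series_norm _ _ _ mu (fun m x => psi m.+1 x - psi m x) 4) => // m.
      exact: bounded_measurableB.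
    apply: (translate_mean_parallelogram Tsystem bf cmin) => //.
    rewrite (le_trans (psic m.+1))// lerD2l exprS ler_piMl// ?ltW//.
    by rewrite invf_lt1// ltr1n.
  apply: filterS => x cx.
  rewrite (_ : (fun m => _) =
    (fun m => psi 0%N x + series (telescope (psi^~ x)) m)); last first.
    by apply/funext => m; rewrite -eq_sum_telescope.
  apply: is_cvgD; first exact: is_cvg_cst.
  exact: normed_cvg.
pose F x := limn_sup (fun m => psi m x).
have Fcvg x : cvgn (fun m => psi m x) -> psi m x @[m --> \oo] --> F x.
  by move=> cx; rewrite /F (cvg_limn_inf_sup cx).2.
have mF : measurable_fun [set: X] F.
  apply: measurable_fun_limn_sup => [x _|x _|m]; last by case: (bpsi m).
  - by exists M => _ [m _ <-]; rewrite (le_trans (ler_norm _)).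
  - by exists (- M) => _ [m _ <-]; rewrite lerNl (le_trans (ler_norm _))// normrN.
have Finv g : \forall x \ae mu, F (T g x) = F x.
  have : \forall x \ae mu, cvgn (series (fun m => `|psi m (T g x) - psi m x|)).
    apply: (@ae_cvg_series_norm _ _ _ mu (fun m x => psi m (T g x) - psi m x) 4) => // m.
      apply: bounded_measurableB => //.
      exact: (translate_mean_bounded Tsystem bf (translate_mean_comp Tsystem g (tpsi m))).
    apply: (translate_mean_parallelogram Tsystem bf cmin) => //.
      exact: (translate_mean_comp Tsystem g (tpsi m)).
    by rewrite (mean_invariant (mT g) (Tinv g) (bounded_measurableX (bpsi m))).
  apply: filterS2 cvgpsi => x cx /cvg_series_cvg_0 dx.
  have := cvgD (norm_cvg0 dx) (Fcvg x cx); rewrite add0r => lim.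
  suff lim' : psi m (T g x) @[m --> \oo] --> F x.
    by rewrite {1}/F (cvg_limn_inf_sup lim').2.
  rewrite (_ : (fun m => psi m (T g x)) =
    (fun m => psi m (T g x) - psi m x) \+ (fun m => psi m x)); first exact: lim.
  by apply/funext => m /=; rewrite subrK.
have M0 : 0 <= M by rewrite (le_trans _ (fM point)).
(* Dominated convergence is needed for the identity and for the square. *)
have dct (k : R -> R) (C : R) : continuous k -> measurable_fun [set: R] k ->
    (forall r, `|r| <= M -> `|k r| <= C) ->
    mu.-integrable [set: X] (fun x => (k (F x))%:E) /\
    (\int[mu]_x (k (psi m x))%:E @[m --> \oo] --> \int[mu]_x (k (F x))%:E)%E.
  move=> ck mk kC.
  have [] // := @dominated_convergence _ _ _ mu [set: X] measurableT
    (fun m x => (k (psi m x))%:E) (fun x => (k (F x))%:E) (fun=> C%:E).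
  - by move=> m; apply/measurable_EFinP; apply: measurableT_comp; [|case: (bpsi m)].
  - by apply/measurable_EFinP; exact: measurableT_comp.
  - apply: filterS cvgpsi => x /Fcvg cx _; apply: cvg_EFin; first exact: nearW.
    exact: (continuous_cvg _ (ck _) cx).
  - exact: (bounded_measurable_integrable mu (bounded_measurable_cst _ C)).
  - by apply: aeW => x m _; rewrite lee_fin kC.
have [intF] := dct id M (fun=> cvg_id) (@measurable_id _ _ _) (fun r rM => rM).
rewrite (_ : (fun m => \int[mu]_x (id (psi m x))%:E)%E = fun=> 0%E); last first.
  apply/funext => m; rewrite -EFin_Rintegral//.
  by rewrite (translate_mean_mean Tsystem bf (tpsi m)) f0.
move=> /(cvg_unique (@ereal_hausdorff R) (cvg_cst _))/esym/= meanF.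
(* It suffices that |F| <= t almost everywhere, as t ^ 2 < e. *)
pose t := Num.sqrt (e / 2).
have e20 : 0 < e / 2 by rewrite divr_gt0.
have t0 : 0 < t by rewrite sqrtr_gt0.
have tt : t ^+ 2 = e / 2 by rewrite sqr_sqrtr// ltW.
have mle r : measurable [set x | F x <= r] by exact: measurable_sublevel.
have int_cst (r : R) : (\int[mu]_x (r%:E) = r%:E)%E.
  by have := EFin_Rintegral mu (bounded_measurable_cst X r); rewrite mean_cst.
have icst (r : R) : mu.-integrable [set: X] (EFin \o (fun=> r)).
  exact: (bounded_measurable_integrable mu (bounded_measurable_cst _ r)).
have ae_of_null (A : set X) : measurable A -> mu A = 0%E -> \forall x \ae mu, ~ A x.
  by move=> mA A0; exists A; split => // x /= /contrapT.
have geN : \forall x \ae mu, - t < F x.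
  have [F0|F1] := ergodic_level_sets Gcountable Tsystem Tergodic (- t) mF Finv.
    apply: filterS (ae_of_null _ (mle (- t)) F0) => x /= /negP.
    by rewrite -ltNge.
  exfalso.
  have : mu (~` [set x | F x <= - t]) = 0%E.
    by rewrite probability_setC// F1 subee.
  move=> /(ae_of_null _ (measurableC (mle (- t)))) ae.
  suff : (0 <= (- t)%:E :> \bar R)%E by rewrite lee_fin lerNr oppr0 leNgt t0.
  rewrite -meanF -int_cst; apply: (ae_le_integral intF (icst _)).
  by apply: filterS ae => x /= /contrapT; rewrite lee_fin.
have leP : \forall x \ae mu, F x <= t.
  have [F0|F1] := ergodic_level_sets Gcountable Tsystem Tergodic t mF Finv; last first.
    have : mu (~` [set x | F x <= t]) = 0%E.
      by rewrite probability_setC// F1 subee.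
    by move=> /(ae_of_null _ (measurableC (mle t))); apply: filterS => x /= /contrapT.
  exfalso.
  suff : (t%:E <= 0 :> \bar R)%E by rewrite lee_fin leNgt t0.
  rewrite -meanF -int_cst; apply: (ae_le_integral (icst _) intF).
  apply: filterS (ae_of_null _ (mle t) F0) => x /= /negP.
  by rewrite -ltNge lee_fin => /ltW.
have [intF2 lim2] := dct (fun r => r ^+ 2) (M ^+ 2) (@exprn_continuous R 2)
  (measurable_funX 2 (@measurable_id _ _ _))
  (fun r rM => ltac:(by rewrite normrX lerXn2r ?nnegrE)).
have : (\int[mu]_x (F x ^+ 2)%:E <= (t ^+ 2)%:E)%E.
  rewrite -int_cst; apply: (ae_le_integral intF2 (icst _)).
  apply: filterS2 geN leP => x /ltW Ft tF; rewrite lee_fin.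
  by rewrite -real_normK ?num_real// lerXn2r ?nnegrE ?(ltW t0)// ler_norml Ft.
have : (e%:E <= \int[mu]_x (F x ^+ 2)%:E)%E.
  rewrite -(cvg_lim _ lim2)//; apply: lime_ge; first by apply/cvg_ex; eexists; exact: lim2.
  apply: nearW => m; rewrite -EFin_Rintegral; last exact: bounded_measurableX.
  by rewrite lee_fin lbe.
move=> h1 h2; have := le_trans h1 h2; rewrite lee_fin tt.
by apply/negP; rewrite -ltNge; lra.
Qed.

Definition ergodic_average (A : {fset G}) (f : X -> R) (x : X) : R :=
  #|` A|%:R^-1 * \sum_(g <- A) f (T g x).

Lemma bounded_measurable_average A f : bounded_measurable f ->
  bounded_measurable (ergodic_average A f).
Proof.
have [_ mT _ _ _] := Tsystem => bf.
apply: bounded_measurableZ; apply: bounded_measurable_sum => g.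
exact: bounded_measurable_comp.
Qed.

(** The square of an average is at most the average of the squares, which has the
    integral of f ^ 2 by invariance. *)
Lemma mean_square_average A f : A != fset0 -> bounded_measurable f ->
  \int[mu]_x (ergodic_average A f x ^+ 2) <= \int[mu]_x (f x ^+ 2).
Proof.
have [_ mT Tinv _ _] := Tsystem => A0 bf.
have bT g : bounded_measurable (fun x => f (T g x)) := bounded_measurable_comp (mT g) bf.
have c0 : 0 < #|` A|%:R :> R by rewrite ltr0n cardfs_gt0.
apply: (@le_trans _ _ (\int[mu]_x (ergodic_average A (fun x => f x ^+ 2) x))).
  apply: le_mean.
  - exact/bounded_measurableX/bounded_measurable_average.
  - exact/bounded_measurable_average/bounded_measurableX.
  move=> x; rewrite /ergodic_average; set m := _ * \sum_(g <- A) f _.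
  rewrite -(ler_pM2l c0) mulVKf ?gt_eqF//.
  have : \sum_(g <- A) (2 * m * f (T g x) - m ^+ 2) <= \sum_(g <- A) f (T g x) ^+ 2.
    apply: ler_sum => g _; rewrite -subr_ge0.
    rewrite (_ : _ - _ = (f (T g x) - m) ^+ 2) ?sqr_ge0//; by ring.
  rewrite sumrB -mulr_sumr big_const_seq count_predT iter_addr_0.
  have -> : \sum_(g <- A) f (T g x) = #|` A|%:R * m by rewrite /m mulVKf ?gt_eqF.
  rewrite -mulr_natl; apply: le_trans; rewrite le_eqVlt; apply/orP; left; apply/eqP.
  by ring.
rewrite /ergodic_average meanZ; last first.
  by apply: bounded_measurable_sum => g; exact: bounded_measurableX.
rewrite mean_sum; last by move=> g; exact: bounded_measurableX.
under eq_bigr do rewrite (mean_invariant (mT _) (Tinv _) (bounded_measurableX bf)).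
by rewrite big_const_seq count_predT iter_addr_0 -[X in _ * X]mulr_natl mulKf ?gt_eqF.
Qed.

(** Replacing f by f o T^g replaces the set F n over which f is averaged by
    g F n; as F is a Folner sequence this changes the average by a uniformly small
    amount. *)
Lemma translate_mean_average (F : nat -> {fset G}) f a M e : folner R F ->
  (forall x, `|f x| <= M) -> translate_mean T f a -> 0 < e ->
  \forall n \near \oo, forall x,
    `|ergodic_average (F n) a x - ergodic_average (F n) f x| <= e.
Proof.
move=> [F0 Fol] fM ta; have [_ _ _ _ TM] := Tsystem.
elim: ta e => [g|b c _ IHb _ IHc] e e0; last first.
  near=> n => x.
  have /(_ x) : forall x, `|ergodic_average (F n) b x - ergodic_average (F n) f x| <= e.
    by near: n; exact: IHb.
  have /(_ x) : forall x, `|ergodic_average (F n) c x - ergodic_average (F n) f x| <= e.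
    by near: n; exact: IHc.
  have -> : ergodic_average (F n) (fun x => 2^-1 * (b x + c x)) x =
      2^-1 * (ergodic_average (F n) b x + ergodic_average (F n) c x).
    by rewrite /ergodic_average -mulr_sumr big_split/=; ring.
  by rewrite !ler_norml => /andP[? ?] /andP[? ?]; apply/andP; split; lra.
have M0 : 0 <= M by rewrite (le_trans _ (fM point)).
have eM : 0 < e / (2 * (M + 1)) by rewrite divr_gt0// mulr_gt0// ltr_wpDl.
have /cvgrPdist_le/(_ _ eM) Fole := Fol g.
near=> n => x.
have c0 : 0 < #|` F n|%:R :> R by rewrite ltr0n cardfs_gt0 F0.
have := @sum_fset_diff R _ [fset (g * y)%g | y in F n]%fset (F n)
  (fun h => f (T h x)) M (fun h => fM _).
rewrite big_imfset/=; last by move=> ? ? _ _; exact: mulgI.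
rewrite card_imfset/=; last exact: mulgI.
have : `|1 - #|` [fset (g * x)%g | x in F n] `&` F n|%fset%:R / #|` F n|%:R : R|
    <= e / (2 * (M + 1)).
  by near: n; exact: Fole.
move=> /(le_trans (ler_norm _)); set i := #|` _|%fset => ie.
rewrite /ergodic_average -mulrBr normrM ger0_norm ?invr_ge0// => sume.
under eq_bigr do rewrite -TM.
rewrite ler_pdivrMl// (le_trans sume)//.
have : #|` F n|%:R - i%:R <= #|` F n|%:R * (e / (2 * (M + 1))).
  by rewrite -ler_pdivrMl// mulrBr mulVf ?gt_eqF// mulrC.
move=> h; apply: (@le_trans _ _ (M * (2 * (#|` F n|%:R * (e / (2 * (M + 1))))))).
  by apply: ler_wpM2l => //; lra.
rewrite (_ : M * _ = #|` F n|%:R * e * (M / (M + 1))); last by field; lra.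
by rewrite ler_piMr ?mulr_ge0 ?(ltW e0)// ler_pdivrMr ?mul1r ?lerDl// ltr_wpDl.
Unshelve. all: by end_near. Qed.

(** The averages of the centred function f0 are uniformly close to those of a mean
    of translates with small L2 norm, and averaging does not increase this norm;
    Markov's inequality concludes. *)
Theorem mean_ergodic (F : nat -> {fset G}) (f : X -> R) (delta e : R) :
  folner R F -> bounded_measurable f -> 0 < delta -> 0 < e ->
  \forall n \near \oo,
    (mu [set x | (delta <= `|ergodic_average (F n) f x - \int[mu]_z f z|)%R]
      <= e%:E)%E.
Proof.
move=> Fol bf d0 e0.
pose f0 x := f x - \int[mu]_z f z.
have bf0 : bounded_measurable f0.
  exact: bounded_measurableB bf (bounded_measurable_cst _ _).
have meanf0 : \int[mu]_x f0 x = 0.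
  by rewrite meanB ?mean_cst ?subrr//; exact: bounded_measurable_cst.
have d2 : 0 < delta / 2 by rewrite divr_gt0.
have [a [ta ae]] := translate_mean_small bf0 meanf0
  (mulr_gt0 (exprn_gt0 2 d2) e0).
have ba := translate_mean_bounded Tsystem bf0 ta.
have [_ [M f0M]] := bf0.
near=> n.
have Fn0 : F n != fset0 by case: (Fol).
have c0 : #|` F n|%:R != 0 :> R by rewrite pnatr_eq0 cardfs_eq0.
have close : forall x, `|ergodic_average (F n) a x - ergodic_average (F n) f0 x| <= delta / 2.
  by near: n; exact: (translate_mean_average Fol f0M ta).
have f0E x : ergodic_average (F n) f0 x = ergodic_average (F n) f x - \int[mu]_z f z.
  rewrite /ergodic_average sumrB big_const_seq count_predT iter_addr_0 mulrBr.
  by rewrite -[X in _ - _ * X]mulr_natl mulKf.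
have b2 := bounded_measurableX (bounded_measurable_average (F n) ba).
apply: (@le_trans _ _ (mu [set x | ((delta / 2) ^+ 2 <= ergodic_average (F n) a x ^+ 2)%R])).
  apply: le_measure; rewrite ?inE.
  - have [mA _] := bounded_measurable_norm
      (bounded_measurableB (bounded_measurable_average (F n) bf)
        (bounded_measurable_cst _ (\int[mu]_z f z))).
    exact: measurable_superlevel.
  - by case: b2 => mb2 _; exact: measurable_superlevel.
  move=> x /=; rewrite -f0E => dx; have closex := close x.
  rewrite -[leRHS]real_normK ?num_real// lerXn2r ?nnegrE ?(ltW d2)//.
  have := lerB_dist (ergodic_average (F n) f0 x) (ergodic_average (F n) a x).
  by move: closex; rewrite distrC; lra.
apply: (le_trans (markov_bounded mu b2 _ _)) => //.
- by move=> x; exact: sqr_ge0.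
- by rewrite exprn_gt0.
rewrite lee_fin ler_pdivrMl ?exprn_gt0//.
by rewrite (le_trans (mean_square_average Fn0 ba))// ltW.
Unshelve. all: by end_near. Qed.

End MeanErgodic.

(** * Disintegrations *)

Section Disintegration.
Context (R : realType) (dX dY : measure_display)
  (X : measurableType dX) (Y : measurableType dY).

Lemma measurable_point (y : Y) : standard_borel R Y -> measurable [set y].
Proof.
move=> [P [f [hP _ bf fmeas]]]; apply/fmeas.
have -> : f @` [set y] = [set f y] by rewrite image_set1.
rewrite -[X in <<s _ >> X]setCK -[X in <<s _ >> X]setTD.
apply: sigma_algebraCD; apply: sub_sigma_algebra => /=.
by apply: closed_openC; exact: (accessible_closed_set1 (hausdorff_accessible hP)).
Qed.

Lemma pkernel_le1 (k : R.-pker Y ~> X) y (A : set X) :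
  measurable A -> (k y A <= 1)%E.
Proof.
move=> mA; apply: (@le_trans _ _ (k y [set: X])); last by rewrite prob_kernel.
by apply: le_measure; rewrite ?inE.
Qed.

(** A kernel with a dummy parameter, so that integration against mu becomes a
    composition of kernels. *)
Definition pull_kernel (k : R.-pker Y ~> X) (uy : unit * Y) :
  {measure set X -> \bar R} := k uy.2.

Section PullKernel.
Variable k : R.-pker Y ~> X.

Let measurable_pull_kernel U : measurable U ->
  measurable_fun [set: unit * Y] (pull_kernel k ^~ U).
Proof.
by move=> mU; apply: (measurableT_comp (measurable_kernel k U mU)); exact: measurable_snd.
Qed.

HB.instance Definition _ := isKernel.Build _ _ _ _ R (pull_kernel k) measurable_pull_kernel.

Let pull_kernel_prob uy : pull_kernel k uy [set: X] = 1%E.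
Proof. exact: prob_kernel. Qed.

HB.instance Definition _ :=
  Kernel_isProbability.Build _ _ _ _ R (pull_kernel k) pull_kernel_prob.

End PullKernel.

Context (mu : probability X R) (nu : probability Y R) (pi : X -> Y)
  (muy : R.-pker Y ~> X) (mudisint : disintegration mu nu pi muy).

Lemma integral_disintegration (f : X -> \bar R) : measurable_fun [set: X] f ->
  (forall x, 0 <= f x)%E ->
  (\int[mu]_x f x = \int[nu]_y \int[muy y]_x f x)%E.
Proof.
move=> mf f0; have [mukernel _] := mudisint.
pose l := kprobability (@measurable_cst _ _ unit _ _ (nu : pprobability Y R)).
have := @integral_kcomp _ _ _ unit Y X R l (pull_kernel muy) tt f f0 mf.
rewrite /= => <-; apply: eq_measure_integral => A mA _.
exact: mukernel.
Qed.


End Disintegration.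

Section AlmostEverywhere.
Context (R : realType) (d : measure_display) (X : measurableType d)
  (mu : {measure set X -> \bar R}).

Lemma le_measure_ae (A B : set X) : measurable A -> measurable B ->
  (\forall x \ae mu, A x -> B x) -> (mu A <= mu B)%E.
Proof.
move=> mA mB [N [mN N0 subN]]; rewrite -[leRHS]adde0 -N0.
apply: (le_trans _ (measureU2 _ mB mN)); apply: le_measure; rewrite ?inE//.
  exact: measurableU.
move=> x Ax; have [Bx|nBx] := pselect (B x); [by left|right].
by apply: subN => /(_ Ax).
Qed.

Lemma eq_measure_ae (A B : set X) : measurable A -> measurable B ->
  (\forall x \ae mu, A x <-> B x) -> mu A = mu B.
Proof.
move=> mA mB AB; apply/eqP; rewrite eq_le; apply/andP; split.
  by apply: le_measure_ae => //; apply: filterS AB => x [].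
by apply: le_measure_ae => //; apply: filterS AB => x [].
Qed.

End AlmostEverywhere.

Section Fibres.
Context (R : realType) (dX dY : measure_display)
  (X : measurableType dX) (Y : measurableType dY)
  (mu : probability X R) (nu : probability Y R) (pi : X -> Y)
  (muy : R.-pker Y ~> X) (mudisint : disintegration mu nu pi muy)
  (Yborel : standard_borel R Y) (mpi : measurable_fun [set: X] pi).

(** Points of Y are measurable as Y is standard, so the fibre over y carries the
    whole mass of muy y and its complement is a null set. *)
Lemma ae_fibre : \forall y \ae nu, \forall x \ae muy y, pi x = y.
Proof.
have [_ fib] := mudisint; apply: filterS fib => y fy.
have mfib : measurable (pi @^-1` [set y]).
  by rewrite -[X in measurable X]setTI; apply: mpi => //; exact: measurable_point Yborel.
exists (~` (pi @^-1` [set y])); split => //; first exact: measurableC.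
have muyT : muy y [set: X] = 1%E by exact: prob_kernel.
have muylt : (muy y [set: X] < +oo)%E by rewrite muyT ltry.
transitivity (muy y [set: X] - muy y (pi @^-1` [set y]))%E.
  by rewrite -setTD measureD// setTI.
by rewrite muyT fy subee.
Qed.

Lemma ae_disintegration (Q : X -> Prop) : (\forall x \ae mu, Q x) ->
  \forall y \ae nu, \forall x \ae muy y, Q x.
Proof.
move=> [N [mN N0 subN]]; have [mukernel _] := mudisint.
have : (\int[nu]_y `|muy y N| = 0)%E.
  by rewrite -[RHS]N0 mukernel//; apply: eq_integral => y _; rewrite gee0_abs.
move=> /(ae_eq_integral_abs _ measurableT (measurable_kernel muy N mN)).
by apply: filterS => y /(_ I) yN; exists N.
Qed.


(** For almost every y, muy y gives A :&: pi @^-1` B the mass of A if B contains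
    y, and 0 otherwise. *)
Lemma disintegration_preimage (A : set X) (B : set Y) :
  measurable A -> measurable B ->
  (\int[nu]_(y in B) muy y A = mu (A `&` pi @^-1` B))%E.
Proof.
move=> mA mB; have [mukernel _] := mudisint.
have mpiB : measurable (pi @^-1` B) by rewrite -[X in measurable X]setTI; exact: mpi.
rewrite mukernel; last exact: measurableI.
rewrite integral_mkcond; apply: ae_eq_integral => //.
- by apply/(measurable_restrictT _ mB); apply: measurable_funTS; exact: measurable_kernel.
- by apply: measurable_kernel; exact: measurableI.
apply: filterS ae_fibre => y fy _; rewrite /patch; case: ifPn => [|] yB.
  apply: eq_measure_ae => //; first exact: measurableI.
  by apply: filterS fy => x xy; split => [Ax|[]//]; split => //=; rewrite xy; exact: set_mem.
transitivity (muy y set0); first by rewrite measure0.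
apply: eq_measure_ae => //; first exact: measurableI.
by apply: filterS fy => x xy; split => // -[_ /=]; rewrite xy => /mem_set; rewrite (negbTE yB).
Qed.

End Fibres.

Section EquivariantFibres.
Context (R : realType) (G : groupType) (dX dY : measure_display)
  (X : measurableType dX) (Y : measurableType dY)
  (mu : probability X R) (T : G -> X -> X)
  (nu : probability Y R) (S : G -> Y -> Y)
  (Xsystem : mp_system mu T) (Ysystem : mp_system nu S)
  (pi : X -> Y) (pifactor : factor_map mu T nu S pi)
  (muy : R.-pker Y ~> X) (mudisint : disintegration mu nu pi muy).

(** Uniqueness of disintegrations, for one set A at a time: both sides have the same
    integral over every measurable E, namely the measure of the part of
    T g @^-1` A above E.  For the left-hand side this uses the invariance of nu to
    pass from E to its translate E'. *)
Lemma disintegration_equivariant (g : G) (A : set X) : measurable A ->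
  \forall y \ae nu, muy (S g y) A = muy y (T g @^-1` A).
Proof.
move=> mA; have [mpi _ piT] := pifactor.
have [_ mT Tinv _ _] := Xsystem; have [Yborel mS Sinv S1 SM] := Ysystem.
have mTA : measurable (T g @^-1` A) by rewrite -[X in measurable X]setTI; exact: mT.
have mf : measurable_fun [set: Y] (fun y => muy (S g y) A).
  exact: measurableT_comp (measurable_kernel muy A mA) (mS g).
suff : ae_eq nu [set: Y] (fun y => muy (S g y) A) (fun y => muy y (T g @^-1` A)).
  by apply: filterS => y; apply.
apply: integral_ae_eq => //.
- apply/integrableP; split => //.
  apply: (@le_lt_trans _ _ (\int[nu]_y (cst 1 y))%E).
    apply: ge0_le_integral => //; first exact: measurableT_comp.
    by move=> y _; rewrite gee0_abs// pkernel_le1.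
  by rewrite integral_cst// mul1e; apply: le_lt_trans (probability_le1 nu measurableT) (ltry 1).
- exact: measurable_kernel.
move=> E _ mE; rewrite (disintegration_preimage mudisint Yborel mpi mTA mE).
pose E' := S g^-1%g @^-1` E.
have mE' : measurable E' by rewrite -[X in measurable X]setTI; exact: mS.
have EE' : E = S g @^-1` E'.
  by apply/seteqP; split => y; rewrite /E' /= -SM mulVg S1.
have mpiE' : measurable (pi @^-1` E') by rewrite -[X in measurable X]setTI; exact: mpi.
have mpiE : measurable (pi @^-1` E) by rewrite -[X in measurable X]setTI; exact: mpi.
transitivity (\int[nu]_(y in E') muy y A)%E.
  rewrite {1}EE' -(@ge0_integral_pushforward _ _ _ _ R _ (mS g) nu _ (fun y => muy y A))//.
    by apply: eq_measure_integral => B mB _; exact: Sinv.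
  by apply: measurable_funTS; exact: measurable_kernel.
rewrite (disintegration_preimage mudisint Yborel mpi mA mE').
rewrite -(Tinv g); last exact: measurableI.
apply: eq_measure_ae.
- by rewrite -[X in measurable X]setTI; apply: mT => //; exact: measurableI.
- exact: measurableI.
apply: filterS (piT g) => x pix; split => -[/= ? ?]; split => //=.
  by rewrite EE' /= -pix.
by rewrite /= pix; have : (S g @^-1` E') (pi x) by rewrite -EE'.
Qed.

End EquivariantFibres.

(** * Functions of a finite partition *)

Section FinitePartitions.
Context (R : realType) (d : measure_display) (X : measurableType d)
  (la : {measure set X -> \bar R}) (laT : la [set: X] = 1%E)
  (J : finType) (W : X -> J) (mW : measurable_partition W).

Definition cell_mass (j : J) : R := fine (la (W @^-1` [set j])).

Lemma measure_le1 (A : set X) : measurable A -> (la A <= 1)%E.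
Proof. by move=> mA; rewrite -laT le_measure// ?inE. Qed.

Lemma fineK_measure (A : set X) : measurable A -> ((fine (la A))%:E = la A)%E.
Proof.
move=> mA; rewrite fineK// ge0_fin_numE//.
by rewrite (le_lt_trans (measure_le1 mA))// ltry.
Qed.

Lemma measurable_cells (C : pred J) : measurable [set x | C (W x)].
Proof.
rewrite (_ : [set _ | _] = \bigcup_(j in [set j | C j]) W @^-1` [set j]).
  by apply: fin_bigcup_measurable => // j _; exact: mW.
by apply/seteqP; split => [x Cx|x [j /= Cj ->]//]; exists (W x).
Qed.

Lemma measurable_finite_valued (c : J -> R) :
  measurable_fun [set: X] (fun x => c (W x)).
Proof.
move=> _ B mB; rewrite setTI.
have := measurable_cells (fun j => `[< B (c j) >]).
by congr measurable; apply/seteqP; split => x /= /asboolP.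
Qed.

Lemma integral_finite_valued (c : J -> R) : (forall j, 0 <= c j) ->
  (\int[la]_x (c (W x))%:E = (\sum_j cell_mass j * c j)%:E)%E.
Proof.
move=> c0.
transitivity (\int[la]_x (\sum_j (c j)%:E * (\1_(W @^-1` [set j]) x)%:E))%E.
  apply: eq_integral => x _; rewrite (bigD1 (W x))//= indicE mem_set// mule1.
  rewrite big1 ?adde0// => j jW; rewrite indicE memNset ?mule0//.
  by move=> /= /eqP; rewrite eq_sym (negbTE jW).
have mind j : measurable_fun [set: X] (fun x => (\1_(W @^-1` [set j]) x)%:E : \bar R).
  exact/measurable_EFinP/measurable_indic.
have mterm j : measurable_fun [set: X]
    (fun x => (c j)%:E * (\1_(W @^-1` [set j]) x)%:E)%E.
  exact: measurable_funeM.
rewrite (ge0_integral_sum _ measurableT mterm); last first.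
  by move=> j x _; rewrite mule_ge0// lee_fin.
rewrite -sumEFin; apply: eq_bigr => j _.
rewrite ge0_integralZl ?lee_fin//.
by rewrite integral_indic// setIT EFinM muleC fineK_measure.
Qed.

Lemma measure_cells (C : pred J) :
  la [set x | C (W x)] = (\sum_(j | C j) cell_mass j)%:E.
Proof.
have := integral_finite_valued (fun j => ler0n R (C j)).
under eq_integral => x _.
  rewrite (_ : (C (W x))%:R = \1_[set x | C (W x)] x); last first.
    by rewrite indicE; congr (nat_of_bool _)%:R; apply/idP/idP; rewrite inE.
  over.
rewrite integral_indic ?setIT//; last exact: measurable_cells.
move=> ->; congr EFin; rewrite [RHS]big_mkcond/=.
by apply: eq_bigr => j _; case: (C j); rewrite ?mulr1 ?mulr0.
Qed.

Lemma cell_mass_ge0 j : 0 <= cell_mass j.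
Proof. exact: fine_ge0. Qed.

Lemma sum_cell_mass : \sum_j cell_mass j = 1.
Proof.
apply: EFin_inj; rewrite -(measure_cells xpredT) -laT; congr (la _).
by apply/seteqP; split.
Qed.

End FinitePartitions.

(** * Covering a Folner set by translates *)

Section Translates.
Context (G : groupType).
Implicit Types F K : {fset G}.

Definition translates K F : {fset G} :=
  (\bigcup_(k <- K) [fset (k^-1 * f)%g | f in F])%fset.

Lemma mem_translates K F k f : k \in K -> f \in F -> (k^-1 * f)%g \in translates K F.
Proof.
by move=> kK fF; apply/bigfcupP; exists k; rewrite ?kK//; apply/imfsetP; exists f.
Qed.

(** The part of F covered by the translate of K by j. *)
Definition window K F (j : translates K F) : {set F} :=
  [set f : F | (val f * (val j)^-1)%g \in K]%SET.

(** The element f is covered by the translate by j exactly when j = k^-1 f for some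
    k in K. *)
Lemma card_windows K F (f : F) :
  #|[set j : translates K F | f \in window j]%SET| = #|` K|.
Proof.
pose h (k : K) : translates K F := [` mem_translates (valP k) (valP f)]%fset.
have -> : [set j : translates K F | f \in window j]%SET = (h @: [set: K])%SET.
  apply/finset.setP => j; rewrite !finset.inE; apply/idP/imsetP => [jK|[k _ ->]].
    exists [` jK]%fset; rewrite ?finset.in_setT//; apply: val_inj => /=.
    by rewrite invgM invgK mulgVK.
  by rewrite /= invgM invgK mulVKg (valP k).
rewrite card_imset ?cardsT ?cardfE// => k1 k2 /(congr1 val)/= /mulIg/invg_inj.
exact: val_inj.
Qed.

Lemma card_window_le K F (j : translates K F) : (#|window j| <= #|` K|)%N.
Proof.
rewrite -(size_image (fun f : F => (val f * (val j)^-1)%g)); apply: uniq_leq_size.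
  by rewrite map_inj_uniq ?enum_uniq// => f1 f2 /mulIg/val_inj.
by move=> g /mapP[f fj ->]; move: fj; rewrite mem_enum finset.inE.
Qed.

Context (R : realType).

Lemma card_translatesD K F :
  #|` translates K F `\` F|%fset%:R <=
  \sum_(k <- K) (#|` F|%:R - #|` [fset (k^-1 * f)%g | f in F] `&` F|%fset%:R) :> R.
Proof.
rewrite /translates; elim: (enum_fset K) => [|k s IH].
  by rewrite !big_nil fset0D cardfs0.
rewrite !big_cons fsetDUl; set A := [fset _ | f in F]%fset.
have cardA : #|` A| = #|` F| by rewrite card_imfset//=; exact: mulgI.
apply: (@le_trans _ _ (#|` A `\` F|%fset%:R +
    #|` (\bigcup_(j <- s) [fset (j^-1 * f)%g | f in F]) `\` F|%fset%:R)).
  by rewrite -natrD ler_nat cardfsU leq_subr.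
rewrite lerD// cardfsD natrB ?fsubset_leq_card ?fsubsetIl//.
by rewrite cardA.
Qed.

Lemma folner_translatesD K (F : nat -> {fset G}) (e : R) : folner R F -> 0 < e ->
  \forall n \near \oo, #|` translates K (F n) `\` F n|%fset%:R <= e * #|` F n|%:R.
Proof.
move=> [F0 Fol] e0; pose c : R := #|` K|%:R + 1.
have c0 : 0 < c by rewrite ltr_wpDl.
have ec : 0 < e / c by rewrite divr_gt0.
have shift : \forall n \near \oo, forall k : K,
    `|1 - #|` [fset ((val k)^-1 * x)%g | x in F n] `&` F n|%fset%:R / #|` F n|%:R : R|
      <= e / c.
  apply: filter_forall => k.
  by have /cvgrPdist_le/(_ _ ec) := Fol (val k)^-1%g.
near=> n.
have Fn0 : 0 < #|` F n|%:R :> R by rewrite ltr0n cardfs_gt0.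
apply: (le_trans (card_translatesD _ _)).
rewrite big_seq_fsetE/=.
apply: (@le_trans _ _ (\sum_(k : K) e / c * #|` F n|%:R)).
  apply: ler_sum => k _.
  have /(_ k) : forall k : K,
    `|1 - #|` [fset ((val k)^-1 * x)%g | x in F n] `&` F n|%fset%:R / #|` F n|%:R : R|
      <= e / c.
    by near: n; exact: shift.
  move=> /(le_trans (ler_norm _)) /(ler_wpM2r (ltW Fn0)).
  by rewrite mulrBl mul1r divfK ?gt_eqF.
rewrite sumr_const -cardfE -[leLHS]mulr_natl mulrA ler_wpM2r//.
rewrite mulrCA ler_piMr ?(ltW e0)// ler_pdivrMr// mul1r.
by rewrite lerDl.
Unshelve. all: by end_near. Qed.

(** Let K have at least 2 N elements.  The set translates K (F n) contains the
    |K| distinct elements k^-1 f for any f in F n, and for large n it has at most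
    2 |F n| elements. *)
Lemma folner_card_infty (F : nat -> {fset G}) (N : nat) :
  infinite_set [set: G] -> folner R F -> \forall n \near \oo, (N <= #|` F n|)%N.
Proof.
move=> Ginf Fol.
have [K _ KN] := infinite_set_fset (2 * N) Ginf.
have [F0 _] := Fol.
near=> n.
have small : #|` translates K (F n) `\` F n|%fset%:R <= 1 * #|` F n|%:R :> R.
  by near: n; exact: folner_translatesD.
have /fset0Pn[f fF] := F0 n.
have Ktr : (#|` K| <= #|` translates K (F n)|)%N.
  have <- : #|` [fset (k^-1 * f)%g | k in K]%fset| = #|` K|.
    by rewrite card_imfset//= => k1 k2 /mulIg/invg_inj.
  apply: fsubset_leq_card; apply/fsubsetP => _ /imfsetP[k kK ->].
  exact: mem_translates.
have : (#|` translates K (F n)| <= #|` F n| + #|` F n|)%N.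
  rewrite -(cardfsID (F n)); apply: leq_add; first by rewrite fsubset_leq_card ?fsubsetIr.
  by move: small; rewrite mul1r ler_nat.
move=> /(leq_trans Ktr)/(leq_trans KN); rewrite addnn -mul2n leq_mul2l.
by [].
Unshelve. all: by end_near. Qed.

End Translates.

(** * Entropy and information of the fibres *)

Section FibreInformation.
Context (R : realType) (G : groupType) (dX dY : measure_display)
  (X : measurableType dX) (Y : measurableType dY)
  (mu : probability X R) (T : G -> X -> X)
  (nu : probability Y R) (S : G -> Y -> Y)
  (Xsystem : mp_system mu T) (Ysystem : mp_system nu S)
  (pi : X -> Y) (pifactor : factor_map mu T nu S pi)
  (muy : R.-pker Y ~> X) (mudisint : disintegration mu nu pi muy)
  (I : finType) (P : X -> I) (Pmeas : measurable_partition P).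
Implicit Types (F K : {fset G}) (eta : R).

Lemma alphabet_gt0 : (0 < #|I|)%N.
Proof. by apply/card_gt0P; exists (P point). Qed.

Lemma measurable_join_partition F : measurable_partition (join_partition T P F).
Proof.
have [_ mT _ _ _] := Xsystem => u.
rewrite (_ : _ @^-1` _ = \bigcap_(f in [set: F]) (T (val f) @^-1` (P @^-1` [set u f]))).
  apply: fin_bigcap_measurable => //.
  by move=> f _; rewrite -[X in measurable X]setTI; apply: mT => //; exact: Pmeas.
apply/seteqP; split => [x <- f _|x h]; first by rewrite /= ffunE.
by apply/ffunP => f; rewrite ffunE; exact: h.
Qed.

Definition fibre_mass F (y : Y) : {ffun F -> I} -> R :=
  cell_mass (muy y) (join_partition T P F).
Arguments fibre_mass : clear implicits.

Let muyT y : muy y [set: X] = 1%E. Proof. exact: prob_kernel. Qed.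

Lemma fibre_mass_ge0 F y (u : {ffun F -> I}) : 0 <= fibre_mass F y u.
Proof. exact: cell_mass_ge0. Qed.

Lemma sum_fibre_mass F y : \sum_(u : {ffun F -> I}) fibre_mass _ y u = 1.
Proof. by apply: sum_cell_mass; [exact: muyT|exact: measurable_join_partition]. Qed.

Lemma fibre_mass_le1 F y (u : {ffun F -> I}) : fibre_mass _ y u <= 1.
Proof.
by rewrite -(sum_fibre_mass F y) (bigD1 u)//= lerDl sumr_ge0// => v _; exact: fibre_mass_ge0.
Qed.

Lemma measurable_fibre_mass F (u : {ffun F -> I}) :
  measurable_fun [set: Y] (fun y => fibre_mass _ y u).
Proof.
apply: (measurableT_comp (fine_measurable measurableT)).
by apply: measurable_kernel; exact: measurable_join_partition.
Qed.

Definition fibre_entropy F (y : Y) : R :=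
  - \sum_(u : {ffun F -> I}) fibre_mass _ y u * ln (fibre_mass _ y u).

Lemma fibre_entropy_ge0 F y : 0 <= fibre_entropy F y.
Proof.
rewrite oppr_ge0 sumr_le0// => u _; apply: mulr_ge0_le0; first exact: fibre_mass_ge0.
exact: ln_le0 (fibre_mass_le1 _ _).
Qed.

Lemma fibre_entropy_le F y : fibre_entropy F y <= #|` F|%:R * ln #|I|%:R.
Proof.
apply: (le_trans (entropy_le_ln_card (fibre_mass_ge0 y) (sum_fibre_mass F y))).
rewrite card_ffun natrX lnXn ?posrE ?ltr0n ?alphabet_gt0//.
by rewrite -cardfE -[leLHS]mulr_natl.
Qed.

Lemma bounded_measurable_fibre_entropy F : bounded_measurable (fibre_entropy F).
Proof.
split.
  apply: measurable_funN; apply: measurable_sum => u.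
  apply: measurable_funM; first exact: measurable_fibre_mass.
  by apply: (measurableT_comp (@measurable_ln _)); exact: measurable_fibre_mass.
exists (#|` F|%:R * ln #|I|%:R) => y.
by rewrite ger0_norm ?fibre_entropy_ge0 ?fibre_entropy_le.
Qed.

(** The conditional entropy as a real number; see cond_entropyE. *)
Definition mean_entropy F : R := \int[nu]_y fibre_entropy F y.

Lemma cond_entropyE F :
  cond_entropy nu muy (join_partition T P F) = (mean_entropy F)%:E.
Proof. by rewrite EFin_Rintegral//; exact: bounded_measurable_fibre_entropy. Qed.

Lemma mean_entropy_ge0 F : 0 <= mean_entropy F.
Proof. by apply: Rintegral_ge0 => y _; exact: fibre_entropy_ge0. Qed.

Definition smoothed_mass eta F (y : Y) (u : {ffun F -> I}) : R :=
  (1 - eta) * fibre_mass _ y u + eta * #|I|%:R^-1 ^+ #|` F|.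

(** The information of the cell of x given the fibre of x, for smoothed fibre
    measures. *)
Definition smoothed_information eta K (x : X) : R :=
  - ln (smoothed_mass eta (pi x) (join_partition T P K x)).

Section Smoothing.
Context (eta : R) (eta01 : 0 < eta < 1).

Let floor_gt0 K : 0 < eta * #|I|%:R^-1 ^+ #|` K|.
Proof.
by case/andP: eta01 => ? _; rewrite mulr_gt0// exprn_gt0// invr_gt0 ltr0n alphabet_gt0.
Qed.

Lemma smoothed_mass_ge K y (u : {ffun K -> I}) :
  eta * #|I|%:R^-1 ^+ #|` K| <= smoothed_mass eta y u.
Proof.
case/andP: eta01 => _ ?; rewrite lerDr mulr_ge0 ?fibre_mass_ge0//.
by rewrite subr_ge0 ltW.
Qed.

Lemma smoothed_mass_gt0 K y (u : {ffun K -> I}) : 0 < smoothed_mass eta y u.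
Proof. exact: lt_le_trans (floor_gt0 K) (smoothed_mass_ge _ _). Qed.

Lemma smoothed_mass_le1 K y (u : {ffun K -> I}) : smoothed_mass eta y u <= 1.
Proof.
case/andP: eta01 => eta0 eta1; rewrite /smoothed_mass -[leRHS](subrK eta) lerD//.
  by rewrite ler_piMr ?fibre_mass_le1// subr_ge0 ltW.
rewrite ler_piMr ?(ltW eta0)// exprn_ile1// ?invr_ge0// invf_le1 ?ltr0n ?alphabet_gt0//.
by rewrite ler1n alphabet_gt0.
Qed.

Lemma smoothed_information_ge0 K x : 0 <= smoothed_information eta K x.
Proof. by rewrite oppr_ge0 ln_le0// smoothed_mass_le1. Qed.

Lemma bounded_measurable_smoothed_information K :
  bounded_measurable (smoothed_information eta K).
Proof.
have [mpi _ _] := pifactor; split; last first.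
  exists (- ln (eta * #|I|%:R^-1 ^+ #|` K|)) => x.
  rewrite ger0_norm ?smoothed_information_ge0// lerN2 ler_ln ?posrE ?smoothed_mass_gt0//.
  exact: smoothed_mass_ge.
rewrite (_ : smoothed_information eta K = fun x => \sum_(w : {ffun K -> I})
    - ln (smoothed_mass eta (pi x) w) * \1_(join_partition T P K @^-1` [set w]) x).
  apply: measurable_sum => w; apply: measurable_funM; last first.
    by apply: measurable_indic; exact: measurable_join_partition.
  apply: measurable_funN; apply: (measurableT_comp (@measurable_ln _)).
  apply: measurable_funD => //; apply: measurable_funM => //.
  exact: (measurableT_comp (measurable_fibre_mass w) mpi).
apply/funext => x; rewrite (bigD1 (join_partition T P K x))//= indicE mem_set// mulr1.
rewrite big1 ?addr0// => w wx; rewrite indicE memNset ?mulr0//.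
by move=> /= /eqP; rewrite eq_sym (negbTE wx).
Qed.

(** On the fibre over y the information depends on x only through its cell, so its
    integral is a finite sum; compared with the fibre entropy, smoothing costs at
    most - ln (1 - eta), because it multiplies every mass by at least
    1 - eta. *)
Lemma mean_smoothed_information K :
  \int[mu]_x smoothed_information eta K x <= mean_entropy K - ln (1 - eta).
Proof.
have [mpi _ _] := pifactor; have [Yborel _ _ _ _] := Ysystem.
have bphi := bounded_measurable_smoothed_information K.
have bH := bounded_measurable_fibre_entropy K.
case/andP: eta01 => eta0 eta1.
rewrite -(mean_cst nu (ln (1 - eta))) -meanB//; last exact: bounded_measurable_cst.
have bHc := bounded_measurableB bH (bounded_measurable_cst Y (ln (1 - eta))).
have ln0 : 0 <= - ln (1 - eta) by rewrite oppr_ge0 ln_le0// gerBl ltW.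
have H0 y : 0 <= fibre_entropy K y - ln (1 - eta).
  by rewrite addr_ge0 ?fibre_entropy_ge0.
rewrite -lee_fin !EFin_Rintegral//.
rewrite (integral_disintegration mudisint)//; last 2 first.
- by apply/measurable_EFinP; case: bphi.
- by move=> x; rewrite lee_fin smoothed_information_ge0.
apply: ae_ge0_le_integral => //.
- by move=> y _; apply: integral_ge0 => x _; rewrite lee_fin smoothed_information_ge0.
- apply: (measurable_fun_integral_kernel (measurable_kernel muy)).
    by move=> x; rewrite lee_fin smoothed_information_ge0.
  by apply/measurable_EFinP; case: bphi.
- by move=> y _; rewrite lee_fin.
- by apply/measurable_EFinP; case: bHc.
apply: filterS (ae_fibre mudisint Yborel mpi) => y fy _.
have c0 (w : {ffun K -> I}) : 0 <= - ln (smoothed_mass eta y w).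
  by rewrite oppr_ge0 ln_le0// smoothed_mass_le1.
have -> : (\int[muy y]_x (smoothed_information eta K x)%:E =
    \int[muy y]_x (- ln (smoothed_mass eta y (join_partition T P K x)))%:E)%E.
  apply: ae_eq_integral => //.
  - by apply/measurable_EFinP; case: bphi.
  - apply/measurable_EFinP.
    exact: (measurable_finite_valued (@measurable_join_partition K)
      (fun w => - ln (smoothed_mass eta y w))).
  by apply: filterS fy => x <- _.
rewrite (integral_finite_valued (muyT y) (@measurable_join_partition K) c0) lee_fin.
have -> : - ln (1 - eta) = \sum_(w : {ffun K -> I}) fibre_mass K y w * - ln (1 - eta).
  by rewrite -mulr_suml sum_fibre_mass mul1r.
rewrite /fibre_entropy -sumrN -big_split/=; apply: ler_sum => w _.
rewrite -mulrN -mulrDr -/(fibre_mass _ y w).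
have := fibre_mass_ge0 y w; rewrite le_eqVlt => /predU1P[<-|m0].
  by rewrite !mul0r.
rewrite ler_pM2l// -opprD lerN2 -lnM ?posrE ?subr_gt0//.
rewrite ler_ln ?posrE ?smoothed_mass_gt0 ?mulr_gt0 ?subr_gt0//.
by rewrite [leLHS]mulrC /smoothed_mass lerDl (le_trans _ (ltW (floor_gt0 K))).
Qed.

(** The code of multiplicative_shearer for the windows of F that are covered by
    the translates of K. *)
Definition code_length K F (y : Y) (u : {ffun F -> I}) : R :=
  #|` K|%:R^-1 * \sum_(j : translates K F)
    - ln (smoothed_marginal eta (fibre_mass F y) (window j) u).
Arguments code_length : clear implicits.

Let consistent F y : consistent_family (smoothed_marginal eta (fibre_mass F y)).
Proof.
apply: smoothed_marginal_consistent => //; first exact: alphabet_gt0.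
  exact: fibre_mass_ge0.
exact: sum_fibre_mass.
Qed.

Lemma kraft K F y : K != fset0 -> \sum_u expR (- code_length K F y u) <= 1.
Proof.
move=> K0; apply: le_trans (@multiplicative_shearer R F I (translates K F)
  (smoothed_marginal eta (fibre_mass F y)) (@window G K F) #|` K| (consistent F y) _ _ _).
- by apply: ler_sum => u _; rewrite /code_length sumrN mulrN opprK.
- by rewrite cardfs_gt0.
- exact: alphabet_gt0.
- exact: card_windows.
Qed.

Lemma code_length_ge0 K F y u : 0 <= code_length K F y u.
Proof.
case/andP: eta01 => eta0 eta1.
rewrite mulr_ge0 ?invr_ge0// sumr_ge0// => j _; rewrite oppr_ge0 ln_le0//.
rewrite /smoothed_marginal -[leRHS](subrK eta) lerD//.
  rewrite ler_piMr ?subr_ge0 ?(ltW eta1)// -(sum_fibre_mass F y).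
  rewrite [leRHS](bigID (agree (window j) u))/= lerDl sumr_ge0// => v _.
  exact: fibre_mass_ge0.
rewrite ler_piMr ?(ltW eta0)// exprn_ile1// ?invr_ge0// invf_le1 ?ltr0n ?alphabet_gt0//.
by rewrite ler1n alphabet_gt0.
Qed.

Lemma fibre_entropy_le_code K F y : K != fset0 ->
  fibre_entropy F y <= \sum_u fibre_mass F y u * code_length K F y u.
Proof.
move=> K0; apply: (le_trans (gibbs_inequality (fibre_mass_ge0 y) (sum_fibre_mass F y)
  (fun u => expR_gt0 _) (kraft F y K0))).
by apply: ler_sum => u _; rewrite expRK opprK.
Qed.

(** By equivariance, the information of K at T g x is computed in the fibre over
    y from the letters of x at all places of the translate of K by g.  The window
    keeps only the places in F; forgetting letters increases masses, and hence
    shortens the code. *)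
Lemma ae_code_length_le K F : \forall y \ae nu, \forall x \ae muy y,
  code_length K F y (join_partition T P F x) <=
  #|` K|%:R^-1 * \sum_(g <- translates K F) smoothed_information eta K (T g x).
Proof.
have [mpi _ piT] := pifactor; have [Yborel _ _ _ _] := Ysystem.
have [_ mT _ _ TM] := Xsystem; case/andP: eta01 => eta0 eta1.
have equiv : \forall y \ae nu, forall jw : translates K F * {ffun K -> I},
    muy (S (val jw.1) y) (join_partition T P K @^-1` [set jw.2]) =
    muy y (T (val jw.1) @^-1` (join_partition T P K @^-1` [set jw.2])).
  apply: filter_forall => -[j w] /=.
  apply: (disintegration_equivariant Xsystem Ysystem pifactor mudisint).
  exact: measurable_join_partition.
have fac : \forall x \ae mu, forall j : translates K F, pi (T (val j) x) = S (val j) (pi x).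
  by apply: filter_forall => j; exact: piT.
apply: filterS3 equiv (ae_disintegration mudisint fac) (ae_fibre mudisint Yborel mpi).
move=> y equivy; apply: filterS2 => x facx xy.
rewrite /code_length ler_wpM2l ?invr_ge0//.
rewrite big_seq_fsetE/=; apply: ler_sum => j _.
have cons := consistent F y.
rewrite lerN2 ler_ln ?posrE ?smoothed_mass_gt0//; last by case: cons.
rewrite /smoothed_mass /smoothed_marginal lerD//; last first.
  rewrite ler_wpM2l ?(ltW eta0)// ler_wiXn2l ?card_window_le ?invr_ge0//.
  by rewrite invf_le1 ?ltr0n ?ler1n ?alphabet_gt0.
rewrite ler_wpM2l ?subr_ge0 ?(ltW eta1)//.
rewrite /fibre_mass /cell_mass facx xy (equivy (j, _)) /=.
have mW := @measurable_join_partition F.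
rewrite -lee_fin (fineK_measure (muyT y)); last first.
  by rewrite -[X in measurable X]setTI; apply: mT => //; exact: measurable_join_partition.
rewrite -(measure_cells (muyT y) mW); apply: le_measure; rewrite ?inE.
- by rewrite -[X in measurable X]setTI; apply: mT => //; exact: measurable_join_partition.
- exact: measurable_cells.
move=> x' /= Wx'; apply/forall_inP => f; rewrite finset.inE => fj.
have := congr1 (fun w : {ffun K -> I} => w [` fj]%fset) Wx'.
by rewrite !ffunE /= -!TM mulgVK => ->.
Qed.

(** Gibbs' inequality for the code lengths of ae_code_length_le, integrated over
    the fibres and then over Y: a form of Shearer's inequality. *)
Lemma mean_entropy_le_translates K F : K != fset0 ->
  mean_entropy F <= #|` translates K F|%:R / #|` K|%:R *
    \int[mu]_x smoothed_information eta K x.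
Proof.
move=> K0; have [_ mT Tinv _ _] := Xsystem.
have bphi := bounded_measurable_smoothed_information K.
pose f x := #|` K|%:R^-1 * \sum_(g <- translates K F) smoothed_information eta K (T g x).
have bT g := bounded_measurable_comp (mT g) bphi.
have bf : bounded_measurable f.
  by apply: bounded_measurableZ; apply: bounded_measurable_sum => g; exact: bT.
have f0 x : 0 <= f x.
  rewrite mulr_ge0 ?invr_ge0// sumr_ge0// => g _; exact: smoothed_information_ge0.
have <- : \int[mu]_x f x = #|` translates K F|%:R / #|` K|%:R *
    \int[mu]_x smoothed_information eta K x.
  rewrite /f meanZ; last by apply: bounded_measurable_sum => g; exact: bT.
  rewrite mean_sum; last by move=> g; exact: bT.
  under eq_bigr do rewrite (mean_invariant (mT _) (Tinv _) bphi).
  rewrite big_const_seq count_predT iter_addr_0 -[X in _ * X]mulr_natl mulrA.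
  by congr (_ * _); rewrite mulrC.
have mf : measurable_fun [set: X] (EFin \o f) by apply/measurable_EFinP; case: bf.
have bH := bounded_measurable_fibre_entropy F.
rewrite -lee_fin !EFin_Rintegral// (integral_disintegration mudisint mf)//.
apply: ae_ge0_le_integral => //.
- by move=> y _; rewrite lee_fin fibre_entropy_ge0.
- by apply/measurable_EFinP; case: bH.
- by move=> y _; apply: integral_ge0 => x _; rewrite lee_fin.
- by apply: (measurable_fun_integral_kernel (measurable_kernel muy)).
apply: filterS (ae_code_length_le K F) => y codey _.
have mW := @measurable_join_partition F.
apply: (@le_trans _ _ (\int[muy y]_x (code_length K F y (join_partition T P F x))%:E)%E).
  rewrite (integral_finite_valued (muyT y) mW (code_length_ge0 K y)).
  by rewrite lee_fin fibre_entropy_le_code.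
apply: ae_ge0_le_integral => //.
- by move=> x _; rewrite lee_fin code_length_ge0.
- exact/measurable_EFinP/(measurable_finite_valued mW (code_length K F y)).
- by move=> x _; rewrite /= lee_fin.
by apply: filterS codey => x xy _; rewrite /= lee_fin.
Qed.

(** * Covering numbers and entropy of one finite set *)

Lemma hamming_cell F (u : {ffun F -> I}) (eps : R) : 0 <= eps ->
  hamming_diam R T P F (join_partition T P F @^-1` [set u]) <= eps.
Proof.
move=> eps0; rewrite /hamming_diam; set A := [set _ | _ in _ & _ in _].
have A0 : A `<=` [set 0].
  move=> _ [x /= xu [x' /= xu' <-]]; rewrite /hamming big_seq big1 ?mul0r// => f fF.
  have := congr1 (fun w : {ffun F -> I} => w [` fF]%fset) (etrans xu (esym xu')).
  by rewrite !ffunE /= => ->; rewrite eqxx.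
have [A1|noA] := pselect (A !=set0).
  by apply: ge_sup => // a /A0 ->.
suff -> : A = set0 by rewrite sup0.
by apply/eqP; apply: contrapT => /negP/set0P.
Qed.

(** The cells with short codes form the cover; Kraft's inequality counts them. *)
Lemma cov_le_code K F y (a eps : R) : 0 <= eps ->
  K != fset0 ->
  ((1 - eps)%:E <=
    muy y [set x | (code_length K F y (join_partition T P F x) <= a)%R])%E ->
  (cov T P (muy y) F eps <= (expR a)%:E)%E.
Proof.
move=> eps0 K0 large.
pose C := [set u | code_length K F y u <= a]%SET.
have cardC : #|C|%:R <= expR a := card_le_expR a (kraft F y K0).
apply: (@le_trans _ _ (#|C|%:R)%:E); last by rewrite lee_fin.
apply: ereal_inf_lbound.
exists #|C|, (fun i => join_partition T P F @^-1` [set enum_val i]); split => //.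
- by move=> i; exact: measurable_join_partition.
- by move=> i; exact: hamming_cell.
apply: (le_trans large); apply: le_measure; rewrite ?inE.
- exact: (measurable_cells (@measurable_join_partition F)
    (fun u => code_length K F y u <= a)).
- by apply: fin_bigcup_measurable => // i _; exact: measurable_join_partition.
move=> x /= codex; have xC : join_partition T P F x \in C by rewrite finset.inE.
by exists (enum_rank_in xC (join_partition T P F x)) => //=; rewrite enum_rankK_in.
Qed.

(** If E has measure at least 1 - eps ^ 2 then, by Markov's inequality, all fibres
    except for a set of measure eps give E mass at least 1 - eps. *)
Lemma rel_cov_le K F (E : set X) (a eps : R) :
  K != fset0 -> 0 < eps -> measurable E ->
  (forall x, E x -> #|` K|%:R^-1 *
     \sum_(g <- translates K F) smoothed_information eta K (T g x) <= a) ->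
  (mu (~` E) <= (eps ^+ 2)%:E)%E ->
  (rel_cov T P nu muy F eps <= (expR a)%:E)%E.
Proof.
move=> K0 eps0 mE Ea muE; have [mukernel _] := mudisint.
have [N [mN N0 goodN]] := ae_code_length_le K F.
have mEC : measurable (~` E) by exact: measurableC.
pose f y := fine (muy y (~` E)).
have mf : measurable_fun [set: Y] f.
  apply: (measurableT_comp (fine_measurable measurableT)).
  exact: measurable_kernel.
have f0 y : 0 <= f y by exact: fine_ge0.
have fE y : (f y)%:E = muy y (~` E) by apply: fineK_measure.
have bf : bounded_measurable f.
  split => //; exists 1 => y; rewrite ger0_norm// -lee_fin fE.
  exact: (measure_le1 (muyT y)).
have meanf : \int[nu]_y f y <= eps ^+ 2.
  rewrite -lee_fin EFin_Rintegral//; apply: le_trans muE.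
  by rewrite mukernel//; under eq_integral do rewrite fE.
pose B := [set y | eps <= f y] `|` N.
have mB : measurable B by apply: measurableU => //; exact: measurable_superlevel.
have nuB : (nu B <= eps%:E)%E.
  apply: (@le_trans _ _ (nu [set y | (eps <= f y)%R] + nu N)%E).
    exact: (measureU2 _ (measurable_superlevel eps mf) mN).
  rewrite N0 adde0; apply: (le_trans (markov_bounded nu bf f0 eps0)).
  by rewrite lee_fin ler_pdivrMl// -expr2.
apply: (@le_trans _ _ (ereal_sup [set cov T P (muy y) F eps | y in ~` B])).
  apply: ereal_inf_lbound; exists (~` B); split => //; first exact: measurableC.
  rewrite probability_setC// EFinB leeB//.
apply: ge_ereal_sup => _ [y nBy <-].
have [/negP fy nNy] : ~ (eps <= f y) /\ ~ N y by split => h; apply: nBy; [left|right].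
apply: (cov_le_code (ltW eps0) K0).
have goody : \forall x \ae muy y, code_length K F y (join_partition T P F x) <=
    #|` K|%:R^-1 * \sum_(g <- translates K F) smoothed_information eta K (T g x).
  by apply: contrapT => bad; apply: nNy; exact: goodN.
apply: (@le_trans _ _ (muy y E)).
  have muylt : (muy y [set: X] < +oo)%E by rewrite muyT ltry.
  have -> : (muy y E = muy y [set: X] - muy y (~` E))%E.
    by rewrite -{1}(setCK E) -setTD measureD// setTI.
  by rewrite muyT EFinB leeB// -fE lee_fin ltW// ltNge.
apply: le_measure_ae => //.
  exact: (measurable_cells (@measurable_join_partition F)
    (fun u => code_length K F y u <= a)).
by apply: filterS goody => x codex Ex /=; exact: le_trans codex (Ea x Ex).
Qed.

End Smoothing.
Lemma hamming_le_diam F (E : set X) x x' : E x -> E x' ->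
  hamming R T P F x x' <= hamming_diam R T P F E.
Proof.
move=> Ex Ex'; apply: ub_le_sup; last by exists x => //; exists x'.
exists 1 => _ [z _ [z' _ <-]].
have [F0|F0] := posnP #|` F|.
  by rewrite /hamming (cardfs0_eq F0) big_nil mul0r.
rewrite ler_pdivrMr ?ltr0n// mul1r.
apply: (@le_trans _ _ (\sum_(f <- F) 1)).
  by apply: ler_sum => f _; case: (_ != _).
by rewrite big_const_seq count_predT iter_addr_0.
Qed.

(** The words of the points in the covering sets are close to the word of an
    arbitrary point of the covering set, which serves as centre. *)
Lemma fibre_entropy_le_cover F y (eps alpha : R) (M : nat) (E : 'I_M -> set X) :
  F != fset0 -> 0 < eps < 1 -> 0 < alpha < 1 ->
  (forall i, measurable (E i)) -> (forall i, hamming_diam R T P F (E i) <= eps) ->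
  ((1 - eps)%:E <= muy y (\bigcup_i E i))%E ->
  fibre_entropy F y <= ln (2 * M%:R) +
    #|` F|%:R * (- ln (1 - alpha) + eps * ln (#|I|%:R / alpha) + eps * ln #|I|%:R).
Proof.
move=> F0 /andP[eps0 eps1] alpha01 mE diamE largeE.
have M0 : (0 < M)%N.
  case: M E mE diamE largeE => // E _ _.
  rewrite (_ : \bigcup_i E i = set0); last by apply/seteqP; split => // x [[]].
  by rewrite measure0 lee_fin leNgt subr_gt0 eps1.
have mW := @measurable_join_partition F.
pose c i : {ffun F -> I} := join_partition T P F (xget point (E i)).
pose C := [set u : {ffun F -> I} |
  `[< exists2 x, (\bigcup_i E i)%classic x & join_partition T P F x = u >]]%SET.
rewrite cardfE; apply: (@entropy_le_covering R F I M c C) => //.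
- exact: alphabet_gt0.
- exact: ltW.
- exact: fibre_mass_ge0.
- exact: sum_fibre_mass.
- move=> u; rewrite finset.inE => /asboolP[x [i _ Eix] <-]; exists i.
  have Eic : E i (xget point (E i)) by exact: (xgetPex point (ex_intro _ x Eix)).
  have := le_trans (hamming_le_diam F Eix Eic) (diamE i).
  rewrite /hamming ler_pdivrMr ?ltr0n ?cardfs_gt0// big_seq_fsetE/= -cardfE.
  by apply: le_trans; apply: ler_sum => f _; rewrite !ffunE.
rewrite -lee_fin -(measure_cells (muyT y) mW); apply: (le_trans largeE).
apply: le_measure; rewrite ?inE.
- by apply: fin_bigcup_measurable.
- exact: measurable_cells.
by move=> x Ex /=; rewrite finset.inE; apply/asboolP; exists x.
Qed.

(** The last summand accounts for the fibres outside the set S' in the definition of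
    the relative covering number, which have measure at most eps and entropy at
    most |F| ln |I|. *)
Definition covering_loss (eps alpha : R) : R :=
  - ln (1 - alpha) + eps * ln (#|I|%:R / alpha) + eps * ln #|I|%:R
  + eps * ln #|I|%:R.

(** The entropy of all fibres over S' is bounded through their covers, that of the
    other fibres trivially. *)
Lemma rel_cov_ge F (eps alpha : R) :
  F != fset0 -> 0 < eps < 1 -> 0 < alpha < 1 ->
  ((4^-1 * expR (mean_entropy F - #|` F|%:R * covering_loss eps alpha))%:E <=
   rel_cov T P nu muy F eps)%E.
Proof.
move=> F0 eps01 alpha01; have /andP[eps0 eps1] := eps01.
apply: le_ereal_inf_tmp => _ [S' [mS' largeS' ->]].
set z := ereal_sup _.
have covz y : S' y -> (cov T P (muy y) F eps <= z)%E.
  by move=> Sy; apply: ereal_sup_ubound; exists y.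
have cov1 y : (1 <= cov T P (muy y) F eps)%E.
  apply: le_ereal_inf_tmp => _ [M [E [mE _ largeE ->]]]; rewrite lee_fin ler1n.
  case: M E mE largeE => // E _.
  rewrite (_ : \bigcup_i E i = set0); last by apply/seteqP; split => // x [[]].
  by rewrite measure0 lee_fin leNgt subr_gt0 eps1.
have [y0 Sy0] : exists y, S' y.
  apply: contrapT => noS; move: largeS'.
  rewrite (_ : S' = set0); last first.
    by apply/seteqP; split => // y Sy; apply: noS; exists y.
  by rewrite measure0 lee_fin leNgt subr_gt0 eps1.
have z1 : (1 <= z)%E := le_trans (cov1 y0) (covz y0 Sy0).
case zE : z => [s| |]; last 2 first.
- by rewrite leey.
- by move: z1; rewrite zE.
have s1 : 1 <= s by move: z1; rewrite zE lee_fin.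
have s0 : 0 < s by exact: lt_le_trans s1.
(* The covering number is an infimum; since s >= 1, a cover with fewer than 2 s
   sets exists.  The other factor 2 is that of entropy_le_covering. *)
have onS y : S' y -> fibre_entropy F y <= ln (4 * s) +
    #|` F|%:R * (- ln (1 - alpha) + eps * ln (#|I|%:R / alpha) + eps * ln #|I|%:R).
  move=> Sy; have : (cov T P (muy y) F eps < (2 * s)%:E)%E.
    by rewrite (le_lt_trans (covz y Sy))// zE lte_fin; lra.
  move=> /ereal_inf_lt[_ [M [E [mE diamE largeE ->]]]]; rewrite lte_fin => Ms.
  apply: (le_trans (fibre_entropy_le_cover F0 eps01 alpha01 mE diamE largeE)).
  rewrite lerD2r; have [->|M0] := posnP M.
    by rewrite mulr0 (@ln0 R 0)// ln_ge0//; lra.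
  by rewrite ler_ln ?posrE ?mulr_gt0 ?ltr0n//; lra.
rewrite lee_fin ler_pdivrMl// -[leRHS]lnK ?posrE ?mulr_gt0// ler_expR.
have lnI : 0 <= ln #|I|%:R :> R by rewrite ln_ge0// ler1n alphabet_gt0.
set b := ln (4 * s) + _ in onS.
have b0 : 0 <= b.
  by rewrite (le_trans (fibre_entropy_ge0 F y0) (onS y0 Sy0)).
have bind : bounded_measurable (\1_(~` S') : Y -> R).
  split; first exact/measurable_indic/measurableC.
  by exists 1 => y; rewrite indicE ger0_norm// lern1 leq_b1.
have : mean_entropy F <= b + #|` F|%:R * ln #|I|%:R * eps.
  have : mean_entropy F <=
      \int[nu]_y (b + #|` F|%:R * ln #|I|%:R * \1_(~` S') y).
    apply: le_mean.
    - exact: bounded_measurable_fibre_entropy.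
    - by apply: bounded_measurableD; [exact: bounded_measurable_cst|exact: bounded_measurableZ].
    move=> y; rewrite indicE; have [Sy|nSy] := pselect (S' y).
      by rewrite memNset ?mulr0 ?addr0 ?onS//= => /(_ Sy).
    by rewrite mem_set// mulr1 (le_trans (fibre_entropy_le F y))// lerDr.
  rewrite meanD ?meanZ ?mean_cst//; [|exact: bounded_measurable_cst|exact: bounded_measurableZ].
  move=> h; apply: (le_trans h); rewrite lerD2l ler_wpM2l ?mulr_ge0//.
  rewrite -lee_fin EFin_Rintegral// integral_indic ?setIT//; last exact: measurableC.
  apply: (@le_trans _ _ (nu (~` S'))); first by [].
  rewrite probability_setC//.
  by rewrite leeBlDr ?fin_num_measure// addeC -leeBlDr// -EFinB.
by rewrite /b /covering_loss; lra.
Qed.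

(** * The relative entropy rate *)

Definition entropy_rate : R :=
  inf [set mean_entropy K / #|` K|%:R | K in [set K | K != fset0]].

Let rates := [set mean_entropy K / #|` K|%:R | K in [set K | K != fset0]].

Let rate_ge0 K : 0 <= mean_entropy K / #|` K|%:R.
Proof. by rewrite divr_ge0 ?mean_entropy_ge0. Qed.

Let has_inf_rates : has_inf rates.
Proof.
split; last by exists 0 => _ [K _ <-]; exact: rate_ge0.
exists (mean_entropy [fset (1%g : G)]%fset / #|` [fset (1%g : G)]%fset|%:R),
  [fset (1%g : G)]%fset => //=.
by rewrite -cardfs_gt0 cardfs1.
Qed.

Lemma entropy_rate_ge0 : 0 <= entropy_rate.
Proof.
by apply: lb_le_inf; [case: has_inf_rates|move=> _ [K _ <-]; exact: rate_ge0].
Qed.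

Lemma entropy_rate_le K : K != fset0 -> #|` K|%:R * entropy_rate <= mean_entropy K.
Proof.
move=> K0; rewrite -ler_pdivlMl ?ltr0n ?cardfs_gt0// mulrC.
by apply: ge_inf; [case: has_inf_rates|exists K].
Qed.

(** Take K with H(K) / |K| near the infimum and eta with - ln (1 - eta) = e / 2. *)
Lemma smoothed_information_near_rate (e : R) : 0 < e ->
  exists K eta, [/\ K != fset0, 0 < eta < 1 &
    \int[mu]_x smoothed_information eta K x <= #|` K|%:R * (entropy_rate + e)].
Proof.
move=> e0; have e20 : 0 < e / 2 by rewrite divr_gt0.
have [_ [K K0 <-] Ke] := inf_adherent e20 has_inf_rates.
have k0 : 0 < #|` K|%:R :> R by rewrite ltr0n cardfs_gt0.
have k1 : 1 <= #|` K|%:R :> R by rewrite ler1n cardfs_gt0.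
have eta01 : 0 < 1 - expR (- (e / 2)) < 1.
  by rewrite subr_gt0 expR_lt1 oppr_lt0 e20 gtrBl expR_gt0.
exists K, (1 - expR (- (e / 2))); split => //.
apply: (le_trans (mean_smoothed_information eta01 K)).
rewrite subKr expRK opprK; move: Ke; rewrite ltr_pdivrMr// => /ltW Ke.
have : e / 2 <= e / 2 * #|` K|%:R by rewrite ler_peMr// ltW.
by move: Ke; rewrite -/entropy_rate; lra.
Qed.

(** The infimum is a lower bound by definition, and mean_entropy_le_translates gives
    the upper bound, since translates K (F n) is hardly larger than F n. *)
Lemma cvg_entropy_rate (F : nat -> {fset G}) : folner R F ->
  (mean_entropy (F n) / #|` F n|%:R) @[n --> \oo] --> entropy_rate.
Proof.
move=> Fol; have [F0 _] := Fol; apply/cvgrPdist_le => e e0.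
have e20 : 0 < e / 2 by rewrite divr_gt0.
have [K [eta [K0 eta01 Keta]]] := smoothed_information_near_rate e20.
have k0 : 0 < #|` K|%:R :> R by rewrite ltr0n cardfs_gt0.
have he : 0 < entropy_rate + e / 2 by rewrite ltr_wpDl ?entropy_rate_ge0.
have d0 : 0 < e / 2 / (entropy_rate + e / 2) by rewrite divr_gt0.
near=> n.
have c0 : 0 < #|` F n|%:R :> R by rewrite ltr0n cardfs_gt0.
have low : entropy_rate <= mean_entropy (F n) / #|` F n|%:R.
  by rewrite ler_pdivlMr// mulrC entropy_rate_le.
rewrite distrC ger0_norm ?subr_ge0// lerBlDl ler_pdivrMr//.
apply: (le_trans (mean_entropy_le_translates eta01 (F n) K0)).
have cardtr : #|` translates K (F n)|%:R <= #|` F n|%:R * (1 + e / 2 / (entropy_rate + e / 2)).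
  apply: (@le_trans _ _ (#|` F n|%:R + #|` translates K (F n) `\` F n|%fset%:R)).
    rewrite -natrD ler_nat -(cardfsID (F n)) leq_add2r.
    by rewrite fsubset_leq_card// fsubsetIr.
  rewrite mulrDr mulr1 lerD2l [leRHS]mulrC.
  by near: n; exact: folner_translatesD.
apply: (@le_trans _ _ (#|` translates K (F n)|%:R * (entropy_rate + e / 2))).
  rewrite -mulrA ler_wpM2l// ler_pdivrMl//.
apply: (le_trans (ler_wpM2r (ltW he) cardtr)).
rewrite [leLHS](_ : _ = (entropy_rate + e) * #|` F n|%:R) ?lexx//.
by field; rewrite gt_eqF//; lra.
Unshelve. all: by end_near. Qed.

Lemma ks_entropyE : amenable R G -> ks_entropy T P nu muy = entropy_rate%:E.
Proof.
move=> [F0 Fol0].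
have cvgF (F : nat -> {fset G}) : folner R F ->
    ((#|` F n|%:R^-1)%:E * cond_entropy nu muy (join_partition T P (F n)))%E
      @[n --> \oo] --> entropy_rate%:E.
  move=> Fol; under eq_fun do rewrite cond_entropyE -EFinM mulrC.
  by apply: cvg_EFin; [exact: nearW|exact: cvg_entropy_rate].
apply: xget_unique => // h hcvg.
apply: cvg_unique (hcvg _ Fol0) (cvgF _ Fol0).
exact: ereal_hausdorff.
Qed.

(** * Asymptotics of the covering numbers *)

(** Outside the set where the ergodic average of the information over F n is far
    from its mean, the sum of the information over translates K (F n) is at most
    |F n| |K| (h + e), the boundary terms being bounded as the smoothed information
    is. *)
Lemma rel_cov_upper (F : nat -> {fset G}) (eps e : R) :
  countable [set: G] -> ergodic mu T -> folner R F -> 0 < eps -> 0 < e ->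
  \forall n \near \oo,
    (rel_cov T P nu muy (F n) eps <= (expR (#|` F n|%:R * (entropy_rate + e)))%:E)%E.
Proof.
move=> Gcountable Xergodic Fol eps0 e0; have [F0 _] := Fol.
have e40 : 0 < e / 4 by rewrite divr_gt0.
have e20 : 0 < e / 2 by rewrite divr_gt0.
have [K [eta [K0 eta01 Keta]]] := smoothed_information_near_rate e20.
set phi := smoothed_information eta K in Keta *.
have bphi : bounded_measurable phi := bounded_measurable_smoothed_information eta01 K.
have phi0 x : 0 <= phi x := smoothed_information_ge0 eta01 K x.
have [mphi [M phiM]] := bphi.
have M0 : 0 <= M by rewrite (le_trans _ (phiM point)).
have k1 : 1 <= #|` K|%:R :> R by rewrite ler1n cardfs_gt0.
have k0 : 0 < #|` K|%:R :> R by exact: lt_le_trans k1.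
have d0 : 0 < e / 4 / (M + 1) by rewrite divr_gt0// ltr_wpDl.
have sq0 : 0 < eps ^+ 2 by rewrite exprn_gt0.
have erg := mean_ergodic Gcountable Xsystem Xergodic Fol bphi e40 sq0.
near=> n.
have c0 : 0 < #|` F n|%:R :> R by rewrite ltr0n cardfs_gt0.
pose bad := [set x | e / 4 <= `|ergodic_average T (F n) phi x - \int[mu]_z phi z|].
have mbad : measurable bad.
  have [] := bounded_measurable_norm (bounded_measurableB
    (bounded_measurable_average Xsystem (F n) bphi)
    (bounded_measurable_cst _ (\int[mu]_z phi z))).
  by move=> m _; exact: measurable_superlevel.
apply: (@rel_cov_le eta eta01 K (F n) (~` bad)) => //.
- exact: measurableC.
- move=> x /negP; rewrite -ltNge => goodx.
  have bdry : #|` translates K (F n) `\` F n|%fset%:R <= e / 4 / (M + 1) * #|` F n|%:R.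
    by near: n; exact: folner_translatesD.
  have sumF : \sum_(g <- F n) phi (T g x) <= #|` F n|%:R * (\int[mu]_z phi z + e / 4).
    have := le_lt_trans (ler_norm _) goodx.
    by rewrite ltrBlDl => /ltW; rewrite /ergodic_average ler_pdivrMl.
  have sumtr : \sum_(g <- translates K (F n)) phi (T g x) <=
      \sum_(g <- F n) phi (T g x) + M * #|` translates K (F n) `\` F n|%fset%:R.
    rewrite (big_fsetID _ (mem (F n)))/= lerD//.
      rewrite [leRHS](big_fsetID _ (mem (translates K (F n))))/=.
      rewrite (_ : [fset _ | _ in _ & _]%fset = [fset g in F n | g \in translates K (F n)]%fset).
        by rewrite lerDl sumr_ge0.
      by apply/fsetP => g; rewrite !inE andbC.
    rewrite (_ : [fset _ | _ in _ & _]%fset = (translates K (F n) `\` F n)%fset).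
      apply: (@le_trans _ _ (\sum_(g <- (translates K (F n) `\` F n)%fset) M)).
        by apply: ler_sum => g _; rewrite (le_trans (ler_norm _)).
      by rewrite big_const_seq count_predT iter_addr_0 mulr_natr.
    by apply/fsetP => g; rewrite !inE andbC.
  rewrite ler_pdivrMl//; apply: (le_trans sumtr).
  have Mbdry : M * #|` translates K (F n) `\` F n|%fset%:R <= e / 4 * #|` F n|%:R.
    apply: (le_trans (ler_wpM2l M0 bdry)); rewrite mulrA ler_wpM2r//.
    rewrite mulrCA ler_piMr ?(ltW e40)// ler_pdivrMr ?mul1r ?lerDl//.
    by rewrite ltr_wpDl.
  have ek : e / 2 <= #|` K|%:R * (e / 2) by rewrite ler_peMl// ltW.
  apply: (le_trans (lerD sumF Mbdry)).
  rewrite [e / 4 * _]mulrC -mulrDr mulrCA ler_wpM2l//.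
  by move: Keta ek; lra.
by rewrite setCK /bad; near: n; exact: erg.
Unshelve. all: by end_near. Qed.

(** First choose alpha with - ln (1 - alpha) = e / 2, then eps. *)
Lemma covering_loss_small (e : R) : 0 < e ->
  exists eps alpha, [/\ 0 < eps < 1, 0 < alpha < 1 & covering_loss eps alpha <= e].
Proof.
move=> e0; have e20 : 0 < e / 2 by rewrite divr_gt0.
have alpha01 : 0 < 1 - expR (- (e / 2)) < 1.
  by rewrite subr_gt0 expR_lt1 oppr_lt0 e20 gtrBl expR_gt0.
set alpha := 1 - expR (- (e / 2)) in alpha01.
have I1 : 1 <= #|I|%:R :> R by rewrite ler1n alphabet_gt0.
have lnI : 0 <= ln #|I|%:R :> R by exact: ln_ge0.
have lnIa : 0 <= ln (#|I|%:R / alpha).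
  case/andP: alpha01 => alpha0 alpha1.
  by apply: ln_ge0; rewrite ler_pdivlMr// mul1r (le_trans (ltW alpha1)).
pose c := ln (#|I|%:R / alpha) + ln #|I|%:R + ln #|I|%:R.
have c0 : 0 <= c by rewrite !addr_ge0.
have D0 : 0 < c + e / 2 + 1 by lra.
exists (e / 2 / (c + e / 2 + 1)), alpha; split => //.
  by rewrite divr_gt0//= ltr_pdivrMr// mul1r; lra.
rewrite /covering_loss subKr expRK opprK.
have : e / 2 / (c + e / 2 + 1) * c <= e / 2.
  by rewrite -mulrA ler_piMr ?(ltW e20)// mulrC ler_pdivrMr// mul1r; lra.
by rewrite /c; lra.
Qed.

Lemma rel_cov_lower (e : R) : 0 < e ->
  exists2 eps, 0 < eps & forall F, F != fset0 ->
    ((4^-1 * expR (#|` F|%:R * (entropy_rate - e)))%:E <= rel_cov T P nu muy F eps)%E.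
Proof.
move=> e0; have [eps [alpha [eps01 alpha01 loss]]] := covering_loss_small e0.
exists eps => [|F F0]; first by case/andP: eps01.
apply: le_trans (rel_cov_ge F0 eps01 alpha01).
rewrite lee_fin ler_wpM2l ?invr_ge0// ler_expR mulrBr lerB ?entropy_rate_le//.
by rewrite ler_wpM2l.
Qed.

End FibreInformation.

(** * From exponential bounds to growth rates *)

Section UpperLimits.
Context (R : realType) (u : nat -> \bar R).

Lemma limn_esup_le_near (c : \bar R) :
  (\forall n \near \oo, (u n <= c)%E) -> (limn_esup u <= c)%E.
Proof.
move=> uc; apply: (@le_trans _ _ (ereal_sup (u @` [set n | (u n <= c)%E]))).
  by apply: ereal_inf_lbound; exists [set n | (u n <= c)%E].
by apply: ge_ereal_sup => _ [n /= unc <-].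
Qed.

Lemma limn_esup_ge_near (c : \bar R) :
  (\forall n \near \oo, (c <= u n)%E) -> (c <= limn_esup u)%E.
Proof.
move=> uc; apply: le_ereal_inf_tmp => _ [A Aoo <-].
have [n [/= An cn]] := filter_ex (filterI Aoo uc).
by apply: (le_trans cn); apply: ereal_sup_ubound; exists n.
Qed.

End UpperLimits.

Section Logarithms.
Context (R : realType).

Lemma lne_le_expR (x : \bar R) (a : R) : (x <= (expR a)%:E)%E -> (lne x <= a%:E)%E.
Proof.
case: x => [r| |]//=; last by move=> _; rewrite leNye.
rewrite lee_fin => ra; case: ifPn => [_|]; first by rewrite leNye.
rewrite -ltNge => r0.
by rewrite lee_fin -[leRHS](expRK a) ler_ln ?posrE ?expR_gt0.
Qed.

Lemma le_lne (x : \bar R) (a : R) : 0 < a -> (a%:E <= x)%E -> ((ln a)%:E <= lne x)%E.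
Proof.
move=> a0; case: x => [r| |]//=; last by move=> _; rewrite leey.
rewrite lee_fin => ar; have r0 := lt_le_trans a0 ar.
by rewrite ifN -?ltNge// lee_fin ler_ln ?posrE.
Qed.

End Logarithms.

(** The passage from bounds by exponentials to the two forms of the theorem.  Here
    N eps n stands for a covering number, size n for |F n| and h for the entropy;
    the number eps of the lower bound depends on e, which is why a supremum over
    eps appears. *)
Section ExponentialGrowth.
Context (R : realType) (N : R -> nat -> \bar R) (size : nat -> nat) (h : R).
Hypothesis size_infty : forall m, \forall n \near \oo, (m <= size n)%N.
Hypothesis N_upper : forall eps e, 0 < eps -> 0 < e ->
  \forall n \near \oo, (N eps n <= (expR ((size n)%:R * (h + e)))%:E)%E.
Hypothesis N_lower : forall e, 0 < e -> exists2 eps, 0 < eps &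
  forall n, ((4^-1 * expR ((size n)%:R * (h - e)))%:E <= N eps n)%E.

Let size_ge (c : R) : \forall n \near \oo, c <= (size n)%:R.
Proof.
apply: filterS (size_infty (Num.bound `|c|)) => n cn.
rewrite (le_trans (ler_norm _))// (le_trans (ltW (archi_boundP (normr_ge0 c))))//.
by rewrite ler_nat.
Qed.

Let size_gt0 : \forall n \near \oo, 0 < (size n)%:R :> R.
Proof. by apply: filterS (size_infty 1) => n; rewrite ltr0n. Qed.

Lemma growth_infinite (t : R) : t < h ->
  ereal_sup [set limn_esup (fun n => N eps n * ((exp_rate t (size n))^-1)%:E)%E
    | eps in [set e | 0 < e]] = +oo%E.
Proof.
move=> th; pose e := (h - t) / 2.
have e0 : 0 < e by rewrite divr_gt0// subr_gt0.
have [eps eps0 low] := N_lower e0.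
apply/eqyP => A A0; apply: (@le_trans _ _ (limn_esup
  (fun n => N eps n * ((exp_rate t (size n))^-1)%:E)%E)); last first.
  by apply: ereal_sup_ubound; exists eps.
apply: limn_esup_ge_near; apply: filterS (size_ge (4 * A / e)) => n sn.
rewrite lee_pdivlMr ?expR_gt0//; apply: le_trans (low n).
rewrite -EFinM lee_fin ler_pdivlMl//.
have -> : (size n)%:R * (h - e) = (size n)%:R * e + t * (size n)%:R.
  by rewrite /e; field.
rewrite expRD mulrA ler_wpM2r ?expR_ge0//.
move: sn; rewrite ler_pdivrMr// => sn; apply: (le_trans sn).
by rewrite (le_trans _ (expR_ge1Dx _))// lerDr.
Qed.

Lemma growth_zero (t : R) : h < t ->
  ereal_sup [set limn_esup (fun n => N eps n * ((exp_rate t (size n))^-1)%:E)%E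
    | eps in [set e | 0 < e]] = 0%E.
Proof.
move=> ht; apply/eqP; rewrite eq_le; apply/andP; split.
  apply: ge_ereal_sup => _ [eps eps0 <-]; apply/lee_addgt0Pr => d d0; rewrite add0e.
  pose e := (t - h) / 2.
  have e0 : 0 < e by rewrite divr_gt0// subr_gt0.
  apply: limn_esup_le_near.
  apply: filterS2 (N_upper eps0 e0) (size_ge (d^-1 / e)) => n up sn.
  rewrite lee_pdivrMr ?expR_gt0//; apply: (le_trans up).
  rewrite -EFinM lee_fin /exp_rate.
  have -> : t * (size n)%:R = (size n)%:R * e + (size n)%:R * (h + e).
    by rewrite /e; field.
  rewrite expRD mulrA ler_peMl ?expR_ge0// -ler_pdivrMl// mulr1.
  move: sn; rewrite ler_pdivrMr// => sn; apply: (le_trans sn).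
  by rewrite (le_trans _ (expR_ge1Dx _))// lerDr.
have [eps eps0 low] := N_lower ltr01.
apply: (@le_trans _ _ (limn_esup
  (fun n => N eps n * ((exp_rate t (size n))^-1)%:E)%E)); last first.
  by apply: ereal_sup_ubound; exists eps.
apply: limn_esup_ge_near; apply: nearW => n; apply: mule_ge0.
  by apply: (le_trans _ (low n)); rewrite lee_fin mulr_ge0 ?expR_ge0.
by rewrite lee_fin invr_ge0 expR_ge0.
Qed.

Lemma growth_log_rate :
  ereal_sup [set limn_esup (fun n => lne (N eps n) * ((size n)%:R^-1)%:E)%E
    | eps in [set e | 0 < e]] = h%:E.
Proof.
apply/eqP; rewrite eq_le; apply/andP; split.
  apply: ge_ereal_sup => _ [eps eps0 <-]; apply/lee_addgt0Pr => e e0.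
  apply: limn_esup_le_near; apply: filterS2 (N_upper eps0 e0) size_gt0 => n up s0.
  by rewrite lee_pdivrMr// -EFinD -EFinM mulrC; exact: lne_le_expR.
apply/lee_addgt0Pr => e e0; rewrite -leeBlDr// -EFinB.
have e20 : 0 < e / 2 by rewrite divr_gt0.
have [eps eps0 low] := N_lower e20.
apply: (@le_trans _ _ (limn_esup
  (fun n => lne (N eps n) * ((size n)%:R^-1)%:E)%E)); last first.
  by apply: ereal_sup_ubound; exists eps.
apply: limn_esup_ge_near.
apply: filterS2 size_gt0 (size_ge (ln 4 / (e / 2))) => n s0 sn.
rewrite lee_pdivlMr//; have := le_lne _ (low n); rewrite mulr_gt0 ?expR_gt0// => /(_ isT).
apply: le_trans; rewrite -EFinM lee_fin lnM ?posrE ?expR_gt0// expRK lnV ?posrE//.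
by move: sn; rewrite ler_pdivrMr//; lra.
Qed.

End ExponentialGrowth.

Theorem theorem2p14 (R : realType) (G : groupType)
    (Gcountable : countable [set: G]) (Ginfinite : infinite_set [set: G])
    (Gamenable : amenable R G)
    (dX dY : measure_display) (X : measurableType dX) (Y : measurableType dY)
    (mu : probability X R) (T : G -> X -> X)
    (nu : probability Y R) (S : G -> Y -> Y)
    (Xsystem : mp_system mu T) (Ysystem : mp_system nu S)
    (Xergodic : ergodic mu T)
    (pi : X -> Y) (pifactor : factor_map mu T nu S pi)
    (muy : R.-pker Y ~> X) (mudisint : disintegration mu nu pi muy)
    (F : nat -> {fset G}) (Ffolner : folner R F)
    (r : nat) (P : X -> 'I_r) (Pmeas : measurable_partition P) :
  (forall t : R, 0 < t ->
     ((t%:E < ks_entropy T P nu muy)%E ->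
        slow_entropy T P nu muy (exp_rate t) F = +oo%E) /\
     ((ks_entropy T P nu muy < t%:E)%E ->
        slow_entropy T P nu muy (exp_rate t) F = 0%E)) /\
  log_cov_rate T P nu muy F = ks_entropy T P nu muy.
Proof.
have Pm := Pmeas; have [F0 _] := Ffolner.
have size_infty m := folner_card_infty m Ginfinite Ffolner.
pose N eps n := rel_cov T P nu muy (F n) eps.
pose h := entropy_rate T nu muy P.
have upper eps e : 0 < eps -> 0 < e -> \forall n \near \oo,
    (N eps n <= (expR (#|` F n|%:R * (h + e)))%:E)%E.
  exact: (rel_cov_upper Xsystem Ysystem pifactor mudisint Pm Gcountable Xergodic Ffolner).
have lower e : 0 < e -> exists2 eps, 0 < eps & forall n,
    ((4^-1 * expR (#|` F n|%:R * (h - e)))%:E <= N eps n)%E.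
  move=> e0; have [eps eps0 low] := rel_cov_lower nu Xsystem muy Pm e0.
  by exists eps => // n; exact: low.
rewrite (ks_entropyE Xsystem Ysystem pifactor mudisint Pm Gamenable) -/h.
split=> [t _|]; last exact: (growth_log_rate size_infty upper lower).
split; rewrite lte_fin => ht.
- exact: (growth_infinite size_infty lower ht).
- exact: (growth_zero size_infty upper lower ht).
Qed.
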